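(* Let $p$ be a prime, and suppose that $A\subseteq\mathbb{F}_p$ satisfies $100<|A|<0.0045p$. If $|A+A|<2.59|A|-3$, then $A$ is contained in an arithmetic progression in $\mathbb{F}_p$ with at most $|A+A|-|A|+1$ terms.
   Context: $\mathbb{F}_p$ denotes the field (additive group) of prime order $p$. For $A,B$ subsets of an abelian group, $A+B=\{a+b: a\in A, b\in B\}$. *)

(* Defs.v *)
From mathcomp Require Export all_boot all_order all_algebra.

Set Implicit Arguments.
Unset Strict Implicit.
Unset Printing Implicit Defensive.

Import GRing.Theory.
Local Open Scope ring_scope.

Definition sumset (V : finZmodType) (A B : {set V}) : {set V} :=
  [set a + b | a in A, b in B].

(* The terms are a, a + d, ..., a + (k - 1) d. *)
Definition arith_prog (V : finZmodType) (a d : V) (k : nat) : {set V} :=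
  [set a + d *+ i | i : 'I_k].

(* Main.v *)
(* Katz-Koester: [A + A] and its translate by [x] share [A + (A :&: (A + x))].
   Summed against the number of representations of [x] as a difference in [A], and
   compared with Parseval, this yields a Fourier coefficient of [A] of size at least
   [109/150 |A|].  Hence, up to an affine map, at least [259/300 |A|] elements of [A]
   lie in a half-circle.  There sums do not wrap around, so Freiman's [3n - 4]
   theorem covers these elements by a short progression; the other elements of [A]
   must then lie close to it, so [A] itself lies in a half-circle and the [3n - 4]
   theorem applies to all of [A].
   The [3n - 4] theorem reduces the set modulo its largest element [l]; if the sumset
   modulo [l] is too small, Mann's theorem supplies a subgroup of [Z/l] governing its
   structure, and the sums are counted coset by coset. *)
Require Import Defs.
From mathcomp Require Import Rstruct reals trigo.
From mathcomp Require Import zify ring lra.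
Import Order.TTheory GRing.Theory Num.Theory.
Local Open Scope ring_scope.

Set Implicit Arguments.
Unset Strict Implicit.
Unset Printing Implicit Defensive.

(* Cardinals that are equal only up to the choice of canonical structures are
   identified before [lia] is called. *)
Ltac card_lia :=
  clear;
  repeat match goal with
  | |- context [@card.body ?T ?m] =>
    first
    [ match goal with
      | n := @card.body ?T' ?m' |- _ =>
        unify (@card.body T m) (@card.body T' m');
        progress change (@card.body T m) with n
      end
    | let n := fresh "n" in set n := (@card.body T m) ]
  end;
  repeat match goal with n := @card.body _ _ |- _ => clearbody n end;
  clear; lia.

(** The constant [109/150] is [2 * 2.59 / 3 - 1]. A Fourier coefficient of size [M] puts
    [(|A| + M) / 2] elements in a half-circle. For [M = 109/150 |A|] this is [259/300 |A|], and
    three times that is [2.59 |A|], which is what the [3n - 4] theorem requires of these elements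
    when their sumset is bounded by [|A + A|]. The density [0.0045] keeps the trivial frequency from
    dominating the Fourier count. The obstacle inside the [3n - 4] theorem is that [Z/l] may have
    proper subgroups, so Cauchy-Davenport fails there. It holds in [F_p], where the parts of [A]
    lying over single cosets are added instead. *)

Section Sumset.
Variable V : finZmodType.
Implicit Types (A B C X Y H : {set V}) (x y : V).

(** * Sumsets, translates and reflections *)

Lemma sumsetP A B x :
  reflect (exists a b, [/\ a \in A, b \in B & x = a + b]) (x \in sumset A B).
Proof.
apply: (iffP imset2P) => [[a b aA bB ->]|[a [b [aA bB ->]]]]; last by exists a b.
by exists a, b.
Qed.

Lemma mem_sumset A B a b : a \in A -> b \in B -> a + b \in sumset A B.
Proof. by move=> aA bB; apply/sumsetP; exists a, b. Qed.

Lemma sumsetC A B : sumset A B = sumset B A.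
Proof.
by apply/setP=> x; apply/sumsetP/sumsetP=> -[a [b [? ? ->]]]; exists b, a; rewrite addrC.
Qed.

Lemma sumsetA A B C : sumset A (sumset B C) = sumset (sumset A B) C.
Proof.
apply/setP=> x; apply/sumsetP/sumsetP.
  move=> [a [_ [aA /sumsetP[b [c [bB cC ->]]] ->]]].
  by exists (a + b), c; rewrite addrA mem_sumset.
move=> [_ [c [/sumsetP[a [b [aA bB ->]]] cC ->]]].
by exists a, (b + c); rewrite addrA mem_sumset.
Qed.

Lemma sumsetS A A' B B' :
  A \subset A' -> B \subset B' -> sumset A B \subset sumset A' B'.
Proof.
move=> /subsetP sA /subsetP sB; apply/subsetP=> x /sumsetP[a [b [aA bB ->]]].
by rewrite mem_sumset ?sA ?sB.
Qed.

Lemma sumsetUl A B C : sumset (A :|: B) C = sumset A C :|: sumset B C.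
Proof.
apply/setP=> x; rewrite inE; apply/sumsetP/orP.
  move=> [a [c [/setUP[] aA cC ->]]]; [left|right]; exact: mem_sumset.
by move=> [] /sumsetP[a [c [aA cC ->]]]; exists a, c; rewrite inE aA ?orbT.
Qed.

Lemma sub_sumset A B : 0 \in B -> A \subset sumset A B.
Proof. by move=> B0; apply/subsetP=> a aA; rewrite -[a]addr0 mem_sumset. Qed.

Definition translate x A : {set V} := [set x + a | a in A].

Lemma mem_translate x A y : (y \in translate x A) = (y - x \in A).
Proof.
apply/imsetP/idP => [[a aA ->]|yA]; first by rewrite addrC addKr.
by exists (y - x) => //; rewrite addrC subrK.
Qed.

Lemma card_translate x A : #|translate x A| = #|A|.
Proof. by rewrite card_imset //; apply: addrI. Qed.

Lemma sumset_translatel x A B : sumset (translate x A) B = translate x (sumset A B).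
Proof.
apply/setP=> y; rewrite mem_translate; apply/sumsetP/sumsetP => -[a [b [aA bB e]]].
  by exists (a - x), b; rewrite -mem_translate e addrAC.
exists (x + a), b; rewrite mem_translate addrC addKr aA; split=> //.
by rewrite -addrA -e addrC subrK.
Qed.

Lemma sumset1 x B : sumset [set x] B = translate x B.
Proof.
apply/setP=> y; rewrite mem_translate; apply/sumsetP/idP.
  by move=> [a [b [/set1P-> bB ->]]]; rewrite addrC addKr.
by move=> yB; exists x, (y - x); rewrite set11 yB addrC subrK.
Qed.

Definition oppset A : {set V} := [set - a | a in A].

Lemma mem_oppset A x : (x \in oppset A) = (- x \in A).
Proof.
apply/imsetP/idP => [[a aA ->]|xA]; first by rewrite opprK.
by exists (- x); rewrite ?opprK.
Qed.

Lemma card_oppset A : #|oppset A| = #|A|.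
Proof. by rewrite card_imset //; apply: oppr_inj. Qed.

(** [A] and [x - B] are together too large to be disjoint. *)
Lemma card_sumset_pigeonhole A B x :
  (#|[set: V]| < #|A| + #|B|)%N -> x \in sumset A B.
Proof.
move=> lt; set C := translate x (oppset B).
have /set0Pn[a /setIP[aA aC]] : A :&: C != set0.
  rewrite -card_gt0; have := cardsUI A C; move: lt; have := subset_leq_card (subsetT (A :|: C)).
  rewrite card_translate card_oppset; card_lia.
apply/sumsetP; exists a, (x - a); split=> //; last by rewrite addrC subrK.
by move: aC; rewrite mem_translate mem_oppset opprB.
Qed.

(** * Connectivity: atoms, Mann's theorem and Cauchy-Davenport *)

Definition is_subgroup H := (0 \in H) /\ forall x y, x \in H -> y \in H -> x - y \in H.

(* [X] is an admissible competitor in the definition of the connectivity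
   [kappa B = min (#|X + B| - #|X|)]. *)
Definition separates B X := (X != set0) && (sumset X B != setT).

Definition boundary B X := (#|sumset X B| - #|X|)%N.

Lemma boundaryK B X : 0 \in B -> (#|sumset X B| = boundary B X + #|X|)%N.
Proof. by move=> B0; rewrite /boundary subnK // subset_leq_card // sub_sumset. Qed.

(* Submodularity of [X |-> #|X + B|] makes any two atoms (minimizers of the
   boundary that have least cardinality) equal or disjoint, so the atom through
   0 is a subgroup; the bound on the union comes from the dual minimizer
   [- (V \ (X + B))]. *)
Theorem mann_subgroup B X : 0 \in B -> separates B X ->
  exists H, [/\ is_subgroup H, sumset H B != setT &
    forall Y, separates B Y -> (boundary B H <= boundary B Y)%N].
Proof.
move=> B0 sX.
case: (arg_minnP (fun Y => boundary B Y) sX) => F sF minF.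
pose frag Y := separates B Y && (boundary B Y == boundary B F).
have fF : frag F by rewrite /frag sF eqxx.
case: (arg_minnP (fun Y : {set V} => #|Y|) fF) => K /andP[sK /eqP bK] minK.
have atomE : forall Y, frag Y -> #|Y| = #|K| -> forall Z, frag Z -> #|Z| = #|K| ->
    Y :&: Z != set0 -> Y = Z.
  move=> Y /andP[sY /eqP bY] cY Z /andP[sZ /eqP bZ] cZ nI.
  apply/eqP; apply: contraT => neq.
  have ltI : (#|Y :&: Z| < #|K|)%N.
    rewrite ltnNge; apply/negP=> le; case/negP: neq.
    have eI : Y :&: Z = Y by apply/eqP; rewrite eqEcard subsetIl cY.
    by rewrite eqEcard -{1}eI subsetIr cY cZ leqnn.
  have sI : separates B (Y :&: Z).
    rewrite /separates nI; case/andP: sY => _; apply: contra => /eqP e.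
    by rewrite -subTset -e sumsetS ?subsetIl.
  have bI : (boundary B F < boundary B (Y :&: Z))%N.
    rewrite ltn_neqAle (minF _ sI) andbT eq_sym; apply/negP=> e.
    by have := minK (Y :&: Z); rewrite /frag sI e leqNgt ltI => /(_ isT).
  (* [D = - (V \ (Y + B))] is again a minimizer: [D + B] misses [- Y], so its boundary is at most
     that of [Y]. Hence [D] has at least [#|K|] elements. *)
  have dual : (#|K| + #|sumset Y B| <= #|[set: V]|)%N.
    pose D := oppset (~: sumset Y B).
    have cD : (#|D| + #|sumset Y B| = #|[set: V]|)%N by rewrite card_oppset addnC cardsC cardsT.
    have disj : [disjoint oppset Y & sumset D B].
      apply/pred0P=> x /=; apply/andP=> -[]; rewrite mem_oppset => xY.
      move=> /sumsetP[d [b [dD bB xE]]]; move: dD; rewrite mem_oppset inE.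
      case/negP; apply/sumsetP; exists (- x), b; split=> //.
      by rewrite xE opprD subrK.
    have cU : (#|Y| + #|sumset D B| <= #|[set: V]|)%N.
      have := cardsUI (oppset Y) (sumset D B); rewrite (disjoint_setI0 disj) cards0.
      by rewrite card_oppset addn0 => <-; apply: subset_leq_card; apply: subsetT.
    have bYE := boundaryK Y B0; have bDE := boundaryK D B0.
    case/andP: (sY) => Y0 YT.
    have sD : separates B D.
      rewrite /separates -card_gt0; apply/andP; split.
        have := YT; rewrite -properT properEcard subsetT /=; move: cD; card_lia.
      apply/eqP=> e; move: cU; rewrite e.
      by rewrite -[X in (_ <= X)%N]add0n leq_add2r leqn0 cards_eq0 (negPf Y0).
    have bD : boundary B D = boundary B F.
      apply/eqP; rewrite eqn_leq (minF _ sD) andbT -bY.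
      by move: bYE bDE cU cD; card_lia.
    have := minK D; rewrite /frag sD bD eqxx => /(_ isT).
    by move: cD; card_lia.
  have K0 : (0 < #|Y :&: Z|)%N by rewrite card_gt0.
  have e2 := cardsUI Y Z; have e1 := cardsUI (sumset Y B) (sumset Z B).
  rewrite -sumsetUl in e1.
  have bYE := boundaryK Y B0; have bZE := boundaryK Z B0.
  have bIE := boundaryK (Y :&: Z) B0; have bUE := boundaryK (Y :|: Z) B0.
  rewrite bY in bYE; rewrite bZ in bZE.
  have le : (#|sumset (Y :&: Z) B| <= #|sumset Y B :&: sumset Z B|)%N.
    by apply: subset_leq_card; rewrite subsetI !sumsetS ?subsetIl ?subsetIr.
  (* Minimality applies to the union only if its sumset is not everything. By submodularity that
     sumset is smaller than [|K| + |Y + B|], which [dual] bounds by the order of the group. The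
     boundaries of union and intersection add up to at most twice the minimum, while that of the
     intersection exceeds it. *)
  have sU : separates B (Y :|: Z).
    rewrite /separates -card_gt0; apply/andP; split.
      by move: e2 K0 ltI cY cZ; card_lia.
    apply/eqP=> e; rewrite e in e1.
    by move: e1 e2 bYE bZE bIE le K0 ltI dual bI cY cZ; card_lia.
  have := minF _ sU.
  by move: e1 e2 bYE bZE bIE bUE le bI; card_lia.
have fragT x Y : frag Y -> frag (translate x Y).
  rewrite /frag /separates /boundary -!card_gt0 sumset_translatel !card_translate.
  rewrite -!(properT (sumset _ _)) -!(properT (translate _ _)) !properEcard !subsetT.
  by rewrite !card_translate.
have fK : frag K by rewrite /frag sK bK eqxx.
have [k kK] : exists k, k \in K by apply/set0Pn; case/andP: sK.
pose H := translate (- k) K.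
have H0 : 0 \in H by rewrite mem_translate opprK add0r.
have fH : frag H by exact: fragT.
(* For [x] in the atom [H], the atom [H - x] also contains 0, so the two coincide; this is closure
   under differences. *)
have HE : forall x, x \in H -> translate (- x) H = H.
  move=> x xH; apply: atomE; rewrite ?card_translate ?fragT //.
  by apply/set0Pn; exists 0; rewrite inE mem_translate opprK add0r xH.
exists H; case/andP: fH => /andP[_ HB] /eqP bH; split=> //; last by rewrite bH.
split=> // x y xH yH; rewrite -[in X in _ \in X](HE _ yH) mem_translate opprK subrK //.
Qed.

End Sumset.

Lemma subgroup_mulrn (V : finZmodType) (H : {set V}) x k :
  is_subgroup H -> x \in H -> x *+ k \in H.
Proof.
move=> [H0 Hsub] xH; elim: k => [|k IH]; first by rewrite mulr0n.
by rewrite mulrSr -[X in _ + X]opprK; apply: (Hsub) => //; rewrite -sub0r; apply: Hsub.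
Qed.

Lemma subgroup_Fp (p : nat) (H : {set 'F_p}) :
  is_subgroup H -> H = [set 0] \/ H = setT.
Proof.
move=> sH; have [HE|Hn] := boolP (H \subset [set 0]); [left|right].
  by apply/eqP; rewrite eqEsubset HE sub1set; case: sH.
case/subsetPn: Hn => x xH; rewrite inE => x0.
apply/setP=> y; rewrite inE -(divfK x0 y) -[y / x]natr_Zp mulr_natl.
exact: subgroup_mulrn.
Qed.

(** Mann's subgroup is trivial or everything, and the latter is excluded. The boundary of [{0}] is
    [|B| - 1] once [B] is translated to contain 0. *)
Theorem cauchy_davenport (p : nat) (A B : {set 'F_p}) :
  A != set0 -> B != set0 -> (#|A| + #|B| <= #|[set: 'F_p]| + 1)%N ->
  (#|A| + #|B| <= #|sumset A B| + 1)%N.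
Proof.
move=> A0 /set0Pn[b bB] le.
have [sT|sT] := eqVneq (sumset A B) setT; first by rewrite sT.
pose C := translate (- b) B.
have C0 : 0 \in C by rewrite mem_translate opprK add0r.
have cAC : #|sumset A C| = #|sumset A B|.
  by rewrite sumsetC sumset_translatel card_translate sumsetC.
have sC : separates C A.
  rewrite /separates A0; apply: contra sT => /eqP e.
  by rewrite eqEcard subsetT -cAC e /=.
have [H [sH HT /(_ _ sC)]] := mann_subgroup C0 sC.
have e := boundaryK A C0; case: (subgroup_Fp sH) => HE.
  have e1 := boundaryK H C0; move: e e1.
  rewrite HE sumset1 card_translate cards1 cAC card_translate; card_lia.
by case/negP: HT; rewrite HE eqEsubset subsetT sub_sumset.
Qed.

Lemma sum_card_fibre (T T' : finType) (g : T -> T') (S : {set T}) (W : {set T'}) :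
  (\sum_(w in W) #|[set s in S | g s == w]| = #|[set s in S | g s \in W]|)%N.
Proof.
rewrite -[RHS]sum1_card (partition_big g (mem W)) => [|s]; last by rewrite inE => /andP[].
apply: eq_bigr => w wW; rewrite -sum1_card; apply: eq_bigl => s; rewrite !inE.
by case: eqP => [->|]; rewrite ?wW ?andbT ?andbF.
Qed.

(** * Cosets of a subgroup, and subgroups of [Z/l] *)

Section Cosets.
Variables (V : finZmodType) (H : {set V}).
Hypothesis sH : is_subgroup H.
Implicit Types (X Y : {set V}) (x y z : V).

(** Cosets are represented by the sets [translate x H]; this criterion and compatibility with
    addition stand in for a quotient group. *)
Lemma translate_subgroup_eq x y : (translate x H == translate y H) = (x - y \in H).
Proof.
case: sH => H0 Hsub; apply/eqP/idP => [e|xy].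
  by rewrite -mem_translate -e mem_translate subrr.
apply/setP=> z; rewrite !mem_translate; apply/idP/idP => zH.
  by rewrite -[z](subrK x) -addrA -[x - y]opprK Hsub // -sub0r Hsub.
by rewrite -[z](subrK y) -addrA -[y - x]opprB Hsub.
Qed.

Lemma translate_subgroupD x x' y y' :
  translate x H = translate x' H -> translate y H = translate y' H ->
  translate (x + y) H = translate (x' + y') H.
Proof.
case: sH => H0 Hsub /eqP; rewrite translate_subgroup_eq => hx /eqP.
rewrite translate_subgroup_eq => hy; apply/eqP; rewrite translate_subgroup_eq.
by rewrite opprD addrACA -[y - y']opprK Hsub // -sub0r Hsub.
Qed.

Lemma card_sumset_subgroup X :
  #|sumset X H| = (#|[set translate x H | x in X]| * #|H|)%N.
Proof.
set U := imset _ _.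
have -> : sumset X H = [set y in setT | translate y H \in U].
  apply/setP=> y; rewrite !inE /=; apply/sumsetP/imsetP => [[x [k [xX kH ->]]]|[x xX e]].
    by exists x => //; apply/eqP; rewrite translate_subgroup_eq addrC addKr.
  exists x, (y - x); rewrite [x + _]addrC subrK; split=> //.
  by rewrite -translate_subgroup_eq e.
rewrite -sum_card_fibre -sum_nat_const; apply: eq_bigr => w /imsetP[x xX ->].
rewrite -(card_translate x H); apply: eq_card => y; rewrite !inE mem_translate.
exact: translate_subgroup_eq.
Qed.

(** Pigeonhole within one coset: [X] and [z - Y] both lie in [x + H]. *)
Lemma coset_pigeonhole X Y x y z :
  (forall x', x' \in X -> translate x' H = translate x H) ->
  (forall y', y' \in Y -> translate y' H = translate y H) ->
  (#|H| < #|X| + #|Y|)%N ->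
  translate z H = translate (x + y) H -> z \in sumset X Y.
Proof.
move=> hX hY lt ez; set C := translate z (oppset Y).
have sub : X :|: C \subset translate x H.
  apply/subsetP=> t; rewrite mem_translate -translate_subgroup_eq !inE.
  case/orP=> [tX|]; first by rewrite hX.
  rewrite mem_translate mem_oppset opprB => /hY e; apply/eqP.
  have -> : t = (z - (z - t)) by rewrite opprB addrC subrK.
  have -> : x = ((x + y) - y) by rewrite addrK.
  apply: translate_subgroupD => //; move/eqP: e; rewrite translate_subgroup_eq => e.
  apply/eqP; rewrite translate_subgroup_eq -opprB opprK [- _ + _]addrC.
  by move: e; case: (sH) => H0 Hsub /(Hsub _ _ H0); rewrite sub0r.
have /set0Pn[a /setIP[aX aC]] : X :&: C != set0.
  rewrite -card_gt0; have := subset_leq_card sub; have := cardsUI X C; move: lt.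
  rewrite !card_translate card_oppset; card_lia.
apply/sumsetP; exists a, (z - a); split=> //; last by rewrite addrC subrK.
by move: aC; rewrite mem_translate mem_oppset opprB.
Qed.

End Cosets.

Lemma val_addFp (p : nat) (a b : 'F_p) : prime p -> (a + b < p)%N ->
  val (a + b) = (val a + val b)%N.
Proof. by move=> pp lt; rewrite /= modn_small //; apply: leq_trans lt _; rewrite Fp_cast. Qed.

(** [d] is the least positive representative, found by division with remainder. It turns an
    inclusion in [H] into a common divisor of integers. *)
Lemma subgroup_Zn_generator (l : nat) (H : {set 'I_l.+1}) : is_subgroup H ->
  exists2 d, inZp d \in H & forall x, inZp x \in H -> (d %| x)%N.
Proof.
move=> sH; have exd : exists d, (0 < d)%N && ((inZp d : 'I_l.+1) \in H).
  exists l.+1 => /=; case: sH => H0 _.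
  by rewrite (_ : inZp _ = 0 :> 'I_l.+1) //; apply: val_inj; rewrite /= modnn.
case: (ex_minnP exd) => d /andP[d0 dH] dmin; exists d => // x xH.
rewrite /dvdn; case: posnP => // xd.
suff /dmin : (0 < x %% d)%N && ((inZp (x %% d) : 'I_l.+1) \in H).
  by rewrite leqNgt ltn_pmod.
rewrite xd; have -> : inZp (x %% d) = inZp x - (inZp d) *+ (x %/ d) :> 'I_l.+1.
  apply: (addIr ((inZp d) *+ (x %/ d))); rewrite subrK Zp_mulrn.
  apply: val_inj => /=.
  by rewrite modnMml modnDm mulnC addnC -divn_eq.
by case: (sH) => _; apply=> //; apply: subgroup_mulrn.
Qed.


(** * The [3n - 4] theorem for a set with ends 0 and [l.+1] and without common divisor *)

Section Normalized.
Variables (p l : nat) (A : {set 'F_p}).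
Hypotheses (pp : prime p) (lp : (2 * l.+1 < p)%N) (A0 : 0 \in A).
Hypotheses (lA : l.+1%:R \in A) (Al : forall a, a \in A -> (a <= l.+1)%N).
Hypothesis gcdA : forall d, (forall a, a \in A -> (d %| a)%N) -> d = 1%N.

Let S := sumset A A.
Let phi (a : 'F_p) : 'I_l.+1 := inZp (val a).
Let B := [set phi a | a in A].

Let valD a b : a \in A -> b \in A -> val (a + b) = (val a + val b)%N.
Proof. by move=> /Al la /Al lb; apply: val_addFp => //; move: la lb lp; lia. Qed.

Let phiD a b : a \in A -> b \in A -> phi (a + b) = phi a + phi b.
Proof. by move=> aA bA; apply: val_inj; rewrite /phi valD //= modnDm. Qed.

Let val_l : val (l.+1%:R : 'F_p) = l.+1.
Proof. by rewrite /= val_Fp_nat // modn_small //; move: lp; lia. Qed.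

Let phi_l : phi l.+1%:R = 0.
Proof. by apply: val_inj; rewrite /phi val_l /= modnn. Qed.

Let phi0 : phi 0 = 0.
Proof. by apply: val_inj; rewrite /= mod0n. Qed.

Let phiB a : a \in A -> phi a \in B.
Proof. by move=> aA; apply/imsetP; exists a. Qed.

Let phi_inj : {in A :\ l.+1%:R &, injective phi}.
Proof.
move=> a b; rewrite !inE => /andP[al aA] /andP[bl bA] /(congr1 val) /=.
have lt c : c != l.+1%:R -> c \in A -> (val c < l.+1)%N.
  move=> cl /Al; rewrite leq_eqVlt => /orP[/eqP e|//].
  by case/negP: cl; apply/eqP/val_inj; rewrite val_l.
by rewrite !modn_small ?lt // => e; apply: val_inj.
Qed.

Let imB : B = [set phi a | a in A :\ l.+1%:R].
Proof.
apply/setP=> x; apply/imsetP/imsetP => -[a aA ->]; last first.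
  by exists a => //; case/setD1P: aA.
have [->|al] := eqVneq a l.+1%:R; last by exists a; rewrite // !inE al.
exists 0; rewrite ?phi_l ?phi0 // !inE A0 andbT; apply/eqP=> /(congr1 val).
by rewrite val_l.
Qed.

(** Only the two ends [0] and [l.+1] of [A] become equal modulo [l.+1]. *)
Let cardB : (#|B| + 1 = #|A|)%N.
Proof. by rewrite imB card_in_imset // [in RHS](cardsD1 l.+1%:R) lA addnC. Qed.

Let phiS : [set phi s | s in S] = sumset B B.
Proof.
apply/setP=> x; apply/imsetP/sumsetP.
  move=> [_ /sumsetP[a [b [aA bA ->]]] ->].
  by exists (phi a), (phi b); rewrite phiD // !phiB.
move=> [_ [_ [/imsetP[a aA ->] /imsetP[b bA ->] ->]]].
by exists (a + b); rewrite ?phiD ?mem_sumset.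
Qed.

(* Both [a] and [a + l.+1] are sums lying over [phi a], so every fibre over
   [phi a] exceeds 1 by the number of [a] in [A] that it contains. *)
Let card_fibres (C : pred 'I_l.+1) :
  (#|[set x in sumset B B | C x]| + #|[set a in A | C (phi a)]|
     <= #|[set s in S | C (phi s)]|)%N.
Proof.
set AC := [set a in A | _]; set SC := [set s in S | _].
pose L := translate l.+1%:R AC.
have sL : L \subset SC.
  apply/subsetP=> s; rewrite mem_translate inE => /andP[sA Cs]; rewrite inE.
  have e : s = l.+1%:R + (s - l.+1%:R) by rewrite addrC subrK.
  by rewrite e mem_sumset //= phiD // phi_l add0r.
rewrite -(card_translate l.+1%:R AC) -/L.
have -> : #|SC| = (#|SC :\: L| + #|L|)%N.
  by rewrite cardsD (setIidPr sL) subnK // subset_leq_card.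
rewrite leq_add2r; apply: leq_trans (leq_imset_card phi _).
apply: subset_leq_card; apply/subsetP=> x; rewrite inE -phiS => /andP[/imsetP[s sS ->] Cs].
(* The least sum [t] over [phi s] is outside [L]: otherwise [t - l.+1], an element of [A] and so of
   [S], would be a smaller one. Thus [L] misses a point of every fibre. *)
pose Q t := (t \in SC) && (phi t == phi s).
have Qs : Q s by rewrite /Q inE sS Cs eqxx.
case: (arg_minnP (fun t : 'F_p => val t) Qs) => t /andP[tS /eqP et] tmin.
apply/imsetP; exists t => //; rewrite inE tS andbT mem_translate; apply/negP.
rewrite inE => /andP[tA Ct].
have e : t = l.+1%:R + (t - l.+1%:R) by rewrite addrC subrK.
have := tmin (t - l.+1%:R); rewrite /Q inE Ct andbT.
have -> : t - l.+1%:R \in S by rewrite -[_ - _]addr0 mem_sumset.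
have et' : phi (t - l.+1%:R) = phi t by rewrite [in RHS]e [RHS]phiD // phi_l add0r.
have vt : val t = (l.+1 + val (t - l.+1%:R)%R)%N by rewrite {1}e [LHS]valD // val_l.
rewrite et' et eqxx => /(_ isT); rewrite vt.
by rewrite -[X in (_ <= X)%N]add0n leq_add2r.
Qed.

(** The second alternative is the wanted bound on the span; it comes from the fibres when [B + B] is
    everything modulo [l.+1]. In every other case the sumset is shown to be large. *)
Theorem freiman_normalized :
  (3 * #|A| <= #|S| + 3)%N \/ (#|A| + l.+1 <= #|S|)%N.
Proof.
have B0 : 0 \in B by rewrite -phi0 phiB.
have cS : (#|sumset B B| + #|A| <= #|S|)%N.
  apply: leq_trans (leq_trans _ (card_fibres xpredT)) _.
    by rewrite leq_add // subset_leq_card //; apply/subsetP=> x xX; rewrite inE xX.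
  by apply: subset_leq_card; apply/subsetP=> x; rewrite inE => /andP[].
have [BT|nBT] := eqVneq (sumset B B) setT.
  by right; move: cS; rewrite BT cardsT card_ord; card_lia.
have big : (2 * #|B| <= l.+1)%N.
  rewrite leqNgt; apply: contra nBT => lt; rewrite eqEsubset subsetT; apply/subsetP=> x _.
  by apply: card_sumset_pigeonhole; rewrite cardsT card_ord addnn -mul2n.
have [le|small] := leqP (2 * #|B|) (#|sumset B B| + 1); first by left; move: le cS cardB; card_lia.
left.
have sB : separates B B by rewrite /separates nBT andbT; apply/set0Pn; exists 0.
have [H [sH HT minH]] := mann_subgroup B0 sB.
pose pi (x : 'I_l.+1) := translate x H.
pose h := #|H|.
pose U := [set pi x | x in B]; pose W := [set pi x | x in sumset B B].
pose u := #|U|.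
have h0 : (0 < h)%N by apply/card_gt0P; exists 0; case: sH.
have cBH : #|sumset H B| = (u * h)%N by rewrite sumsetC card_sumset_subgroup.
(* Comparing the boundaries of [H] and [B]: at most [h - 2] points of the [u] cosets met by [B] are
   missing from [B]. *)
have few : (u * h + 2 <= #|B| + h)%N.
  have := minH _ sB; have := boundaryK B B0; have := boundaryK H B0.
  by rewrite cBH -/h; move: small; card_lia.
have pi0 : pi 0 = H by apply/setP=> x; rewrite mem_translate subr0.
have UH : H \in U by rewrite -pi0; apply/imsetP; exists 0.
(* If [B] lay in [H], the generator of [H] would divide all of [A], so [H] would be the whole
   group. *)
have u2 : (1 < u)%N.
  rewrite ltnNge; apply/negP=> u1; case/negP: HT; rewrite eqEsubset subsetT /=.
  have BH : B \subset H.
    have /eqP UE : U == [set H] by rewrite eq_sym eqEcard sub1set UH cards1.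
    apply/subsetP=> x xB; have : pi x \in U by apply/imsetP; exists x.
    by rewrite UE => /set1P; rewrite -[RHS]pi0 => /eqP; rewrite translate_subgroup_eq // subr0.
  have [d dH ddiv] := subgroup_Zn_generator sH.
  have d1 : d = 1%N by apply: gcdA => a aA; apply: ddiv; apply: (subsetP BH); apply: phiB.
  apply/subsetP=> x _; apply: (subsetP (sub_sumset _ B0)).
  have -> : x = inZp 1 *+ val x.
    by apply: val_inj; rewrite Zp_mulrn /= modnMml mul1n modn_small.
  by apply: subgroup_mulrn => //; rewrite -d1.
(* [B + B] meets at least [2 u - 1] cosets: minimality is applied to [B + H], or, if [B + H + B] is
   everything, [|W| h = l.+1] is compared with [2 |B|]. *)
have W2 : (2 * u <= #|W| + 1)%N.
  have cW : #|sumset (sumset B H) B| = (#|W| * h)%N.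
    by rewrite -sumsetA [sumset H B]sumsetC sumsetA card_sumset_subgroup.
  have [e|ne] := eqVneq (sumset (sumset B H) B) setT.
    rewrite e cardsT card_ord in cW.
    rewrite -ltnS -(ltn_pmul2r h0); move: cW big few; card_lia.
  have sBH : separates B (sumset B H).
    rewrite /separates ne andbT; apply/set0Pn; exists 0.
    by rewrite -[0]addr0 mem_sumset //; case: sH.
  rewrite -(leq_pmul2r h0).
  have := minH _ sBH; have := boundaryK (sumset B H) B0; have := boundaryK H B0.
  rewrite cW [sumset B H]sumsetC cBH -/h; card_lia.
have UW : U \subset W by apply: imsetS; apply: sub_sumset.
pose f w := #|[set s in S | pi (phi s) == w]|.
pose b w := #|[set x in B | pi x == w]|.
have sumf : (\sum_(w in W) f w <= #|S|)%N.
  by rewrite sum_card_fibre subset_leq_card //; apply/subsetP=> s; rewrite inE => /andP[].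
have sumb : (\sum_(w in U) b w = #|B|)%N.
  rewrite sum_card_fibre; apply: eq_card => x; rewrite inE andb_idr // => xB.
  by apply/imsetP; exists x.
have bh w : w \in U -> (b w <= h)%N.
  case/imsetP=> x xB ->; rewrite /h -(card_translate x H); apply: subset_leq_card.
  by apply/subsetP=> y; rewrite inE translate_subgroup_eq // mem_translate => /andP[].
have b2 w w' : w \in U -> w' \in U -> w != w' -> (#|B| <= b w + b w' + (u - 2) * h)%N.
  move=> wU w'U ww'; rewrite -sumb (bigD1 w) //= (bigD1 w') /=; last by rewrite w'U eq_sym.
  rewrite addnA leq_add2l.
  have -> : ((u - 2) * h = \sum_(i in U :\ w :\ w') h)%N.
    rewrite sum_nat_const; congr (_ * _)%N; rewrite /u (cardsD1 w U) wU.
    by rewrite (cardsD1 w' (U :\ w)) !inE eq_sym ww' w'U /= !add1n !subSS subn0.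
  apply: (@leq_trans (\sum_(i in U :\ w :\ w') b i)).
    by apply: eq_leq; apply: eq_bigl => i; rewrite !inE andbC [(i != w) && _]andbC.
  by apply: leq_sum => i; rewrite !inE => /and3P[_ _ iU]; apply: bh.
pose Ac c := [set a in A | pi (phi a) == c].
have bA e : (b e <= #|Ac e|)%N.
  apply: leq_trans (leq_imset_card phi _); apply: subset_leq_card.
  apply/subsetP=> x; rewrite inE => /andP[/imsetP[a aA ->] ae].
  by apply/imsetP; exists a => //; rewrite inE aA.
have fD c d w : c \in U -> d \in U ->
  (forall x y, pi x = c -> pi y = d -> pi (x + y) = w) ->
  (#|Ac c| + #|Ac d| <= f w + 1)%N.
  move=> cU dU cdw.
  have An e : e \in U -> Ac e != set0.
    case/imsetP=> _ /imsetP[a aA ->] ->; apply/set0Pn; exists a.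
    by rewrite inE aA eqxx.
  have cA e : (#|Ac e| <= #|A|)%N.
    by apply: subset_leq_card; apply/subsetP=> a; rewrite inE => /andP[].
  have sub : sumset (Ac c) (Ac d) \subset [set s in S | pi (phi s) == w].
    apply/subsetP=> _ /sumsetP[x [y [/[!inE] /andP[xA /eqP xc] /andP[yA /eqP yd] ->]]].
    by rewrite mem_sumset //= phiD // cdw.
  apply: leq_trans (cauchy_davenport (An c cU) (An d dU) _) _; last first.
    by rewrite leq_add2r; apply: subset_leq_card.
  have := cA c; have := cA d; rewrite cardsT card_Fp //.
  by move: big cardB lp; card_lia.
(* By [b2] and [few], the parts of [B] in [w] and in [H] have more than [h] elements together, so
   their sums fill [w]; the elements of [A] over [w] count once more. *)
have fold w : w \in U -> w != H -> (h + b w <= f w)%N.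
  move=> wU wH; have := card_fibres (fun x => pi x == w); rewrite -/(f w).
  apply: leq_trans; apply: leq_add; last first.
    exact: bA.
  case/imsetP: (wU) => x xB wx.
  rewrite /h -(card_translate x H); apply: subset_leq_card; apply/subsetP=> z zx.
  have zw : pi z = pi x by apply/eqP; rewrite translate_subgroup_eq // -mem_translate.
  rewrite inE zw wx eqxx andbT.
  apply: (subsetP (@sumsetS _ [set x in B | pi x == w] B [set x in B | pi x == H] B _ _)).
  - by apply/subsetP=> t; rewrite inE => /andP[].
  - by apply/subsetP=> t; rewrite inE => /andP[].
  apply: (@coset_pigeonhole _ H sH _ _ x 0).
  - by move=> t; rewrite inE wx => /andP[_ /eqP].
  - by move=> t; rewrite inE -{1}pi0 => /andP[_ /eqP].
  - have := b2 _ _ wU UH wH; rewrite -/(b w) -/(b H) -/h; move: few u2.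
    by move: (u) => -[|[|v]] //; rewrite !mulSn subSS subSS subn0; move: (b w) (b H); card_lia.
  by rewrite addr0.
have piD c d x y x' y' : pi x = c -> pi y = d -> pi x' = c -> pi y' = d ->
  pi (x + y) = pi (x' + y').
  by move=> <- <- ex ey; apply: translate_subgroupD.
(* Both ends of [A] lie over 0, so [A] has at least [b H + 1] elements over [H]. *)
have fH : (2 * b H + 1 <= f H)%N.
  have cA1 : (b H + 1 <= #|Ac H|)%N.
    rewrite (cardsD1 l.+1%:R (Ac H)) inE lA phi_l pi0 eqxx addnC leq_add2l.
    apply: leq_trans (leq_imset_card phi _); apply: subset_leq_card.
    apply/subsetP=> x; rewrite inE imB => /andP[/imsetP[a aA ->] ae].
    by apply/imsetP; exists a => //; move: aA; rewrite !inE ae andbT.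
  have := fD H H H UH UH; have : forall x y, pi x = H -> pi y = H -> pi (x + y) = H.
    by move=> x y xH yH; rewrite (piD H H x y 0 0) ?addr0.
  by move=> e /(_ e); move: cA1; move: (f H) (b H); card_lia.
(* A coset outside [U] is a sum of two cosets of [U], neither of them [H]. The case [c = d] matters
   because then [c] determines [w]. *)
have fnew w : w \in W -> w \notin U -> exists2 c, c \in U :\ H & exists2 d, d \in U :\ H &
    (b c + b d <= f w + 1)%N /\ (c = d -> forall x, pi x = c -> pi (x + x) = w).
  case/imsetP=> _ /sumsetP[x [y [xB yB ->]]] -> wU.
  have xU : pi x \in U by apply/imsetP; exists x.
  have yU : pi y \in U by apply/imsetP; exists y.
  exists (pi x).
    rewrite !inE xU andbT; apply: contra wU => /eqP xH.
    by rewrite (piD H (pi y) x y 0 y) // add0r.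
  exists (pi y).
    rewrite !inE yU andbT; apply: contra wU => /eqP yH.
    by rewrite (piD (pi x) H x y x 0) // addr0.
  split; last by move=> xy t tx; apply: (piD (pi x) (pi x)).
  apply: leq_trans (leq_add (bA _) (bA _)) (fD _ _ _ xU yU _).
  by move=> x' y' xx yy; apply: piD xx yy _ _.
have sumW : (\sum_(w in W) f w = f H + \sum_(w in U :\ H) f w + \sum_(w in W :\: U) f w)%N.
  rewrite (big_setID U) /= (setIidPr UW); congr (_ + _)%N; exact: big_setD1.
have sumU : (f H + \sum_(w in U :\ H) f w >= (u - 1) * h + #|B| + b H + 1)%N.
  have sU : ((u - 1) * h + \sum_(w in U :\ H) b w <= \sum_(w in U :\ H) f w)%N.
    have -> : ((u - 1) * h = \sum_(w in U :\ H) h)%N.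
      by rewrite sum_nat_const /u (cardsD1 H U) UH addKn.
    by rewrite -big_split; apply: leq_sum => w; rewrite !inE => /andP[wH wU]; apply: fold.
  move: sumb; rewrite (big_setD1 H UH) /=; move: sU fH.
  move: (\sum_(w in U :\ H) b w)%N (\sum_(w in U :\ H) f w)%N (f H) (b H).
  by card_lia.
have b2' c d : c \in U -> d \in U -> c != d -> (h + 2 <= b c + b d)%N.
  move=> cU dU cd; have := b2 _ _ cU dU cd; move: few u2.
  by move: (u) => -[|[|v]] //; rewrite !mulSn subSS subSS subn0; move: (b c) (b d); card_lia.
have b3 c : c \in U :\ H -> (#|B| <= b c + b H + (u - 2) * h)%N.
  by rewrite !inE => /andP[cH cU]; apply: b2.
have fmin w : w \in W :\: U -> (2 * #|B| <= f w + 1 + 2 * b H + 2 * ((u - 2) * h))%N.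
  rewrite inE => /andP[wU wW]; have [c cU [d dU [le _]]] := fnew w wW wU.
  by have := b3 c cU; have := b3 d dU; move: le; move: (b c) (b d) (f w) (b H); card_lia.
have fbig w : w \in W :\: U -> (f w < h + 1)%N ->
    exists2 c, c \in U & (2 * b c < h + 2)%N /\ forall x, pi x = c -> pi (x + x) = w.
  rewrite inE => /andP[wU wW] lt; have [c cU [d dU [le e]]] := fnew w wW wU.
  move: cU dU; rewrite !inE => /andP[_ cU] /andP[_ dU].
  have [cd|cd] := eqVneq c d; last first.
    by have := b2' _ _ cU dU cd; move: le lt; move: (b c) (b d) (f w); card_lia.
  exists c => //; split; last exact: e.
  by rewrite -cd in le; move: le lt; move: (b c) (f w); card_lia.
have WU : (u <= #|W :\: U| + 1)%N.
  by rewrite cardsD (setIidPr UW); move: W2; rewrite /u; card_lia.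
(* At most one new coset has [f w <= h]: it is the double of a coset [c] with [2 * b c < h + 2], and
   by [b2'] there is at most one such [c]. *)
have [w1 w1W w1max] : exists2 w, w \in W :\: U &
    forall w', w' \in W :\: U -> w' != w -> (h + 1 <= f w')%N.
  have [/existsP[w /andP[wW wlt]]|] := boolP [exists w, (w \in W :\: U) && (f w < h + 1)%N].
    exists w => // w' w'W; apply: contraR; rewrite -ltnNge => w'lt.
    have [c cU [bc cw]] := fbig w wW wlt; have [c' c'U [bc' c'w']] := fbig w' w'W w'lt.
    have [e|ne] := eqVneq c c'.
      case/imsetP: cU => x _ cx; rewrite -(cw x) // -(c'w' x) ?eqxx //.
      by rewrite -e.
    by have := b2' _ _ cU c'U ne; move: bc bc'; move: (b c) (b c'); card_lia.
  rewrite negb_exists => /forallP no.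
  have /set0Pn[w wW] : W :\: U != set0 by rewrite -card_gt0; move: WU u2; card_lia.
  by exists w => // w' w'W _; have := no w'; rewrite w'W -leqNgt.
have sumnew : (f w1 + (u - 2) * (h + 1) <= \sum_(w in W :\: U) f w)%N.
  rewrite (big_setD1 w1 w1W) /= leq_add2l.
  apply: (@leq_trans (\sum_(w in W :\: U :\ w1) (h + 1))).
    rewrite sum_nat_const leq_mul2r; apply/orP; right.
    by move: WU; rewrite (cardsD1 w1 (W :\: U)) w1W; card_lia.
  by apply: leq_sum => w; rewrite in_setD1 => /andP[w1w wW]; apply: w1max.
(* The lower bounds add up to [3 |B| + (h - b H) + (u - 2)], which is at least
   [3 |B| = 3 |A| - 3]. *)
have := fmin _ w1W; move: sumf sumW sumU sumnew (bh _ UH) cardB u2.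
move: (f w1) (b H) (f H) (\sum_(w in W :\: U) f w)%N
  (\sum_(w in U :\ H) f w)%N (\sum_(w in W) f w)%N.
move: (u) => -[|[|v]] //; rewrite !subSS !subn0; card_lia.
Qed.

End Normalized.

(** * Affine maps, and the [3n - 4] theorem in [F_p] *)

Section Affine.
Variable p : nat.
Implicit Types (A X : {set 'F_p}) (a d : 'F_p).

Definition affine a d X : {set 'F_p} := [set a + d * x | x in X].

Lemma mem_affine a d X x : x \in X -> a + d * x \in affine a d X.
Proof. by move=> xX; apply/imsetP; exists x. Qed.

Lemma affineK a d X : d != 0 -> affine (- a / d) d^-1 (affine a d X) = X.
Proof.
move=> d0; rewrite /affine -imset_comp -[RHS]imset_id; apply: eq_imset => x /=.
by field.
Qed.

Lemma affine_inj a d : d != 0 -> injective (fun x => a + d * x).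
Proof. by move=> d0 x y /addrI /(mulfI d0). Qed.

Lemma card_affine a d X : d != 0 -> #|affine a d X| = #|X|.
Proof. by move=> d0; rewrite card_imset //; apply: affine_inj. Qed.

Lemma sumset_affine a d X Y :
  sumset (affine a d X) (affine a d Y) = affine (a + a) d (sumset X Y).
Proof.
apply/setP=> z; apply/sumsetP/imsetP.
  move=> [_ [_ [/imsetP[x xX ->] /imsetP[y yY ->] ->]]].
  by exists (x + y); [exact: mem_sumset | ring].
move=> [_ /sumsetP[x [y [xX yY ->]]] ->].
by exists (a + d * x), (a + d * y); rewrite !mem_affine //; split=> //; ring.
Qed.

Lemma affine_arith_prog a d b e k X :
  X \subset arith_prog b e k -> affine a d X \subset arith_prog (a + d * b) (d * e) k.
Proof.
move=> /subsetP sX; apply/subsetP=> _ /imsetP[x /sX /imsetP[i _ ->] ->].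
by apply/imsetP; exists i => //; rewrite mulrDr addrA mulrnAr.
Qed.

End Affine.

Lemma val_subFp (p : nat) (a b : 'F_p) : prime p -> (b <= a)%N ->
  val (a - b) = (val a - val b)%N.
Proof.
move=> pp le; have -> : a - b = (val a - val b)%:R by rewrite natrB // !natr_Zp.
rewrite /= val_Fp_nat // modn_small //; have := ltn_ord a.
by rewrite [X in (_ < X)%N -> _]Fp_cast //; apply: leq_ltn_trans; apply: leq_subr.
Qed.

Lemma ltn_Fp (p : nat) (a : 'F_p) : prime p -> (val a < p)%N.
Proof. by move=> pp; have := ltn_ord a; rewrite [X in (_ < X)%N -> _]Fp_cast. Qed.

(* Freiman's [3n - 4] theorem, for sets of residues lying in an interval of
   length less than [p / 2], whose sums do not wrap around. *)
Theorem freiman_3n4 (p : nat) (A : {set 'F_p}) : prime p ->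
  (forall a, a \in A -> (2 * val a < p)%N) -> (#|sumset A A| + 4 <= 3 * #|A|)%N ->
  exists a d, d != 0 /\ A \subset arith_prog a d (#|sumset A A| - #|A| + 1).
Proof.
move=> pp Ap small.
have /set0Pn[a1 a1A] : A != set0 by rewrite -card_gt0; move: small; card_lia.
case: (arg_minnP (fun a : 'F_p => val a) a1A) => a0 a0A a0min.
case: (arg_maxnP (fun a : 'F_p => val a) a1A) => aM aMA aMgeq.
have {aMgeq} aMmax a : a \in A -> (val a <= val aM)%N by apply: aMgeq.
have {a1 a1A} valB a : a \in A -> val (a - a0)%R = (val a - val a0)%N.
  by move=> aA; apply: val_subFp => //; apply: a0min.
pose l := val (aM - a0).
have l0 : (0 < l)%N.
  rewrite lt0n; apply/negP => /eqP l0.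
  have sA : A \subset [set a0].
    apply/subsetP=> a aA; rewrite inE -subr_eq0; apply/eqP/val_inj; rewrite valB //=.
    move: l0 (aMmax a aA); rewrite /l valB //=.
    move: (nat_of_ord a) (nat_of_ord aM) (nat_of_ord a0); clear; lia.
  have := subset_leq_card sA; rewrite cards1; have : (0 < #|sumset A A|)%N.
    by apply/card_gt0P; exists (a0 + a0); apply: mem_sumset.
  by move: small; card_lia.
pose g := \big[gcdn/0%N]_(a in A) val (a - a0)%R.
have gdvd a : a \in A -> (g %| val (a - a0)%R)%N.
  by move=> aA; rewrite /g; apply: (biggcdn_inf a).
have g0 : (0 < g)%N by apply: (dvdn_gt0 l0); apply: gdvd.
have gl : (g <= l)%N by apply: dvdn_leq => //; apply: gdvd.
have lp : (2 * l < p)%N.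
  by apply: leq_ltn_trans (Ap _ aMA); rewrite leq_mul2l /= /l valB // leq_subr.
have gN0 : (g%:R : 'F_p) != 0.
  apply/eqP=> /(congr1 val); rewrite /= val_Fp_nat // modn_small; first by lia.
  by move: gl lp; clear; lia.
(* [g] divides every difference as an integer, so division by [g] in the field is exact integer
   division, and [X] starts at 0 and has gcd 1. *)
pose X := affine (- a0 / g%:R) g%:R^-1 A.
have cX : #|X| = #|A| by rewrite card_affine // invr_eq0.
have cS : #|sumset X X| = #|sumset A A| by rewrite sumset_affine card_affine // invr_eq0.
have quotE a : a \in A -> (val (a - a0)%R %/ g)%:R = - a0 / g%:R + g%:R^-1 * a.
  move=> aA; apply: (mulIf gN0).
  rewrite -natrM divnK ?gdvd // [_%:R in LHS]natr_Zp.
  by field.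
have Xmem a : a \in A -> (val (a - a0)%R %/ g)%:R \in X.
  by move=> aA; rewrite quotE // mem_affine.
have Xval x : x \in X -> exists2 a, a \in A & x = (val (a - a0)%R %/ g)%:R.
  by case/imsetP=> a aA ->; exists a; rewrite ?quotE.
have valX a : a \in A -> val ((val (a - a0)%R %/ g)%:R : 'F_p) = (val (a - a0)%R %/ g)%N.
  move=> aA; apply: etrans (val_Fp_nat pp _) _; apply: modn_small.
  exact: leq_ltn_trans (leq_div _ _) (ltn_Fp _ pp).
have [k kE] : exists k, (l %/ g = k.+1)%N.
  by exists (l %/ g).-1; rewrite prednK // divn_gt0.
have [] := @freiman_normalized p k X pp.
- by move: (leq_div l g) lp; rewrite kE; clear; lia.
- by have := Xmem _ a0A; rewrite subrr div0n.
- by rewrite -kE; apply: Xmem.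
- move=> _ /Xval[a aA ->]; rewrite -kE.
  have -> := valX a aA.
  by apply: leq_div2r; rewrite /l !valB // leq_sub2r //; apply: aMmax.
- move=> d dX; apply/eqP; rewrite -dvdn1 -(@dvdn_pmul2l g) // muln1.
  apply/dvdn_biggcdP => a aA.
  have := dX _ (Xmem a aA); have -> := valX a aA.
  by move=> dd; rewrite -(divnK (gdvd a aA)) [X in (_ %| X)%N]mulnC dvdn_pmul2l.
- by rewrite cX cS; move: small; card_lia.
rewrite cX cS -kE => le.
exists a0, g%:R; split=> //.
apply/subsetP=> a aA; apply/imsetP.
have lt : (val (a - a0)%R %/ g < #|sumset A A| - #|A| + 1)%N.
  have : (val (a - a0)%R %/ g <= l %/ g)%N.
    by apply: leq_div2r; rewrite /l !valB // leq_sub2r //; apply: aMmax.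
  by move: le; card_lia.
exists (Ordinal lt) => //=.
by rewrite -mulrnA mulnC divnK ?gdvd // [1 *+ _](natr_Zp (a - a0)) addrC subrK.
Qed.

(** * Representation functions and additive energy *)

Section Representations.
Variables (R : realFieldType) (V : finZmodType).
Implicit Types (A X : {set V}) (g : V -> R).

Definition rdiff A (x : V) : nat := #|[set a in A | a - x \in A]|.
Definition rsum A (s : V) : nat := #|[set a in A | s - a \in A]|.

Lemma sum_rdiff A g :
  \sum_(a in A) \sum_(b in A) g (a - b) = \sum_x (rdiff A x)%:R * g x.
Proof.
under eq_bigr => a _ do rewrite (reindex_inj (inv_inj (subKr a))) /=.
rewrite (exchange_big_dep predT) //=; apply: eq_bigr => x _.
rewrite mulr_natl -sumr_const; apply: eq_big => [a|a _]; first by rewrite inE.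
by rewrite subKr.
Qed.

Lemma sum_rsum A g :
  \sum_(a in A) \sum_(b in A) g (a + b) = \sum_s (rsum A s)%:R * g s.
Proof.
under eq_bigr => a _ do rewrite (reindex_inj (addIr (- a))) /=.
rewrite (exchange_big_dep predT) //=; apply: eq_bigr => x _.
rewrite mulr_natl -sumr_const; apply: eq_big => [a|a _]; first by rewrite inE.
by rewrite addrC subrK.
Qed.

Lemma rdiffN A x : rdiff A (- x) = rdiff A x.
Proof.
rewrite /rdiff -(card_translate x [set a in A | a - - x \in A]).
by apply: eq_card => a; rewrite mem_translate !inE opprK subrK andbC.
Qed.

Lemma sum_rdiff1 A : \sum_x (rdiff A x)%:R = #|A|%:R ^+ 2 :> R.
Proof.
under eq_bigr => x _ do rewrite -[_%:R]mulr1.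
by rewrite -(sum_rdiff A (fun=> 1)) !sumr_const expr2 mulr_natl.
Qed.

Lemma sum_rsum1 A : \sum_x (rsum A x)%:R = #|A|%:R ^+ 2 :> R.
Proof.
under eq_bigr => x _ do rewrite -[_%:R]mulr1.
by rewrite -(sum_rsum A (fun=> 1)) !sumr_const expr2 mulr_natl.
Qed.

(** Both sides count the additive quadruples in [A], since [a - b = c - d] rearranges to
    [a + d = b + c]. *)
Lemma energy_diff_sum A :
  \sum_x (rdiff A x)%:R ^+ 2 = \sum_s (rsum A s)%:R ^+ 2 :> R.
Proof.
under eq_bigr => x _ do rewrite expr2.
under [RHS]eq_bigr => x _ do rewrite expr2.
rewrite -(sum_rdiff A (fun x => (rdiff A x)%:R)) -(sum_rsum A (fun x => (rsum A x)%:R)).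
pose I (a b c : V) : R := (a + b - c \in A)%:R.
have rE (P : pred V) : #|[set a in A | P a]|%:R = \sum_(a in A) (P a)%:R :> R.
  rewrite -sum1_card natr_sum (eq_bigl (fun a => (a \in A) && P a)) => [|a]; last by rewrite inE.
  by rewrite big_mkcondr; apply: eq_bigr => a _; case: (P a).
transitivity (\sum_(a in A) \sum_(b in A) \sum_(c in A) I b c a).
  apply: eq_bigr => a _; apply: eq_bigr => b _; rewrite rE; apply: eq_bigr => c _.
  by rewrite /I opprB addrCA addrA.
rewrite exchange_big; apply: eq_bigr => a _; rewrite exchange_big; apply: eq_bigr => b _.
by rewrite rE.
Qed.

(* Cauchy-Schwarz, in the form [sum (r - n^2 / |S|)^2 >= 0]. *)
Lemma energy_ge A : #|A|%:R ^+ 4 <= #|sumset A A|%:R * \sum_x (rdiff A x)%:R ^+ 2 :> R.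
Proof.
set S := sumset A A; set n : R := #|A|%:R; set s : R := #|S|%:R.
rewrite energy_diff_sum.
have r0 x : x \notin S -> rsum A x = 0%N.
  move=> xS; apply/eqP; rewrite cards_eq0; apply/eqP/setP=> a; rewrite !inE.
  apply: contraNF xS => /andP[aA xaA]; rewrite -[x](subrK a) mem_sumset //.
have sum1 : \sum_(x in S) (rsum A x)%:R = n ^+ 2 :> R.
  rewrite -sum_rsum1 [RHS](bigID (mem S)) /= [X in _ = _ + X]big1 ?addr0 // => x xS.
  by rewrite r0.
have -> : \sum_x (rsum A x)%:R ^+ 2 = \sum_(x in S) (rsum A x)%:R ^+ 2 :> R.
  rewrite [LHS](bigID (mem S)) /= [X in _ + X]big1 ?addr0 // => x xS.
  by rewrite r0 // expr0n.
have : 0 <= \sum_(x in S) (s * (rsum A x)%:R - n ^+ 2) ^+ 2.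
  by apply: sumr_ge0 => x _; apply: sqr_ge0.
under eq_bigr => x _ do rewrite sqrrB exprMn -mulrnAl.
rewrite big_split /= sumrB -mulr_sumr sumr_const.
have -> : \sum_(x in S) (s * (rsum A x)%:R) *+ 2 * n ^+ 2 = s * n ^+ 4 *+ 2.
  rewrite -mulr_suml; under eq_bigr => x _ do rewrite -mulrnAl.
  by rewrite -mulr_sumr sum1; ring.
rewrite -[(n ^+ 2) ^+ 2 *+ _]mulr_natl -/s -/S => h.
set E := \sum_(i in S) _ in h *.
have [s0|s0] := eqVneq s 0.
  have A0 : A = set0.
    apply/eqP; rewrite -subset0; apply/subsetP=> a aA.
    have : (a + a) \in S by apply: mem_sumset.
    by move/eqP: s0; rewrite /s pnatr_eq0 cards_eq0 => /eqP->; rewrite !inE.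
  by rewrite s0 mul0r /n A0 cards0 expr0n.
have sp : 0 < s by rewrite lt_def s0 ler0n.
rewrite -subr_ge0 -(pmulr_rge0 _ sp); apply: le_trans h _.
by rewrite le_eqVlt; apply/predU1P; left; ring.
Qed.

End Representations.

(* Katz-Koester: [A + (A :&: (A + x))] is contained in [S :&: (S + x)]. *)
Lemma katz_koester (p : nat) (A : {set 'F_p}) x :
  prime p -> (2 * #|A| <= p)%N -> (0 < rdiff A x)%N ->
  (#|A| + rdiff A x <= rdiff (sumset A A) x + 1)%N.
Proof.
move=> pp small Ax0; set Ax := [set a in A | a - x \in A].
have AxA : (#|Ax| <= #|A|)%N.
  by apply: subset_leq_card; apply/subsetP=> a; rewrite inE => /andP[].
have sub : sumset A Ax \subset [set s in sumset A A | s - x \in sumset A A].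
  apply/subsetP=> _ /sumsetP[a [b [aA /[!inE] /andP[bA bxA] ->]]].
  by rewrite -[a + b - x]addrA !mem_sumset.
apply: leq_trans (cauchy_davenport _ _ _) _.
- by apply/set0Pn; case/card_gt0P: Ax0 => a; rewrite inE => /andP[aA _]; exists a.
- by rewrite -card_gt0.
- by rewrite cardsT card_Fp //; move: small AxA; card_lia.
by rewrite leq_add2r; apply: subset_leq_card.
Qed.

(** The pointwise bound is weighted by [rdiff A x], which also disposes of the [x] that are not
    differences; the weights sum to [n ^+ 2]. *)
Lemma katz_koester_energy (R : realFieldType) (p : nat) (A : {set 'F_p}) :
  prime p -> (2 * #|A| <= p)%N ->
  #|A|%:R ^+ 3 - #|A|%:R ^+ 2 + \sum_x (rdiff A x)%:R ^+ 2
    <= \sum_x (rdiff (sumset A A) x)%:R * (rdiff A x)%:R :> R.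
Proof.
move=> pp small; set n : R := #|A|%:R.
have -> : n ^+ 3 - n ^+ 2 = \sum_x (n - 1) * (rdiff A x)%:R.
  by rewrite -mulr_sumr sum_rdiff1 -/n; ring.
rewrite -big_split /=; apply: ler_sum => x _; rewrite expr2 -mulrDl.
have [->|r0] := posnP (rdiff A x); first by rewrite !mulr0.
rewrite ler_wpM2r ?ler0n //.
have := katz_koester pp small r0; rewrite -(ler_nat R) !natrD -/n; lra.
Qed.

(** * Fourier analysis on [F_p] with real trigonometric sums *)

Section Characters.
Variables (R : realType) (p : nat).
Hypothesis pp : prime p.

Let p0 : p%:R != 0 :> R.
Proof. by rewrite pnatr_eq0 -lt0n prime_gt0. Qed.

Definition angle (n : nat) : R := (pi *+ 2) * n%:R / p%:R.

Lemma angleD m n : angle (m + n) = angle m + angle n.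
Proof. by rewrite /angle natrD mulrDr mulrDl. Qed.

Lemma angle_period k n : angle (k * p + n) = angle n + (pi *+ 2) *+ k.
Proof.
rewrite angleD addrC; congr (_ + _).
by rewrite /angle natrM mulrA mulfK // mulr_natr.
Qed.

Lemma cos_angle_mod n : cos (angle (n %% p)) = cos (angle n).
Proof. by rewrite [in RHS](divn_eq n p) angle_period (periodicn (@cosD2pi R)). Qed.

Lemma sin_angle_mod n : sin (angle (n %% p)) = sin (angle n).
Proof. by rewrite [in RHS](divn_eq n p) angle_period (periodicn (@sinD2pi R)). Qed.

Definition cosF (x : 'F_p) : R := cos (angle (val x)).
Definition sinF (x : 'F_p) : R := sin (angle (val x)).

Let valDmod (x y : 'F_p) : val (x + y) = ((val x + val y) %% p)%N.
Proof. by rewrite -[x in LHS]natr_Zp -[y in LHS]natr_Zp -natrD; apply: val_Fp_nat. Qed.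

Lemma cosFD x y : cosF (x + y) = cosF x * cosF y - sinF x * sinF y.
Proof. by rewrite /cosF valDmod cos_angle_mod angleD cosD. Qed.

Lemma sinFD x y : sinF (x + y) = sinF x * cosF y + cosF x * sinF y.
Proof. by rewrite /sinF valDmod sin_angle_mod angleD sinD. Qed.

Lemma cosF2sinF2 x : cosF x ^+ 2 + sinF x ^+ 2 = 1.
Proof. exact: cos2Dsin2. Qed.

Lemma cosF0 : cosF 0 = 1.
Proof. by rewrite /cosF /angle mulr0 mul0r cos0. Qed.

Lemma sinF0 : sinF 0 = 0.
Proof. by rewrite /sinF /angle mulr0 mul0r sin0. Qed.

Lemma cosFN x : cosF (- x) = cosF x.
Proof.
have := cosFD x (- x); have := sinFD x (- x); rewrite subrr cosF0 sinF0 => s c.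
rewrite -[LHS]mul1r -(cosF2sinF2 x).
transitivity (cosF x * (cosF x * cosF (- x) - sinF x * sinF (- x))
  + sinF x * (sinF x * cosF (- x) + cosF x * sinF (- x))); first by ring.
by rewrite -s -c mulr1 mulr0 addr0.
Qed.

Lemma sinFN x : sinF (- x) = - sinF x.
Proof.
have := cosFD x (- x); have := sinFD x (- x); rewrite subrr cosF0 sinF0 => s c.
rewrite -[LHS]mul1r -(cosF2sinF2 x).
transitivity (cosF x * (sinF x * cosF (- x) + cosF x * sinF (- x))
  - sinF x * (cosF x * cosF (- x) - sinF x * sinF (- x))); first by ring.
by rewrite -s -c mulr1 mulr0 sub0r.
Qed.

Lemma cosFB x y : cosF (x - y) = cosF x * cosF y + sinF x * sinF y.
Proof. by rewrite cosFD cosFN sinFN; ring. Qed.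

(* The sum of all p-th roots of unity is fixed by the rotation [cosF 1 != 1]. *)
Lemma sum_cosF : \sum_x cosF x = 0.
Proof.
set C := \sum_x _; pose S := \sum_x sinF x.
have eC : C = C * cosF 1 - S * sinF 1.
  rewrite {1}/C (reindex_inj (addIr 1)) /= !mulr_suml -sumrB.
  by apply: eq_bigr => x _; rewrite cosFD.
have eS : S = S * cosF 1 + C * sinF 1.
  rewrite {1}/S (reindex_inj (addIr 1)) /= !mulr_suml -big_split /=.
  by apply: eq_bigr => x _; rewrite sinFD.
have c1 : cosF 1 < 1.
  have v1 : val (1 : 'F_p) = 1%N.
    have := val_Fp_nat pp 1; rewrite modn_small ?prime_gt1 //.
  rewrite /cosF v1 /angle mulr1 -[X in _ < X]cos0 -cos_norm.
  have pi0 := @pi_gt0 R.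
  have p2 : 2 <= p%:R :> R by rewrite ler_nat prime_gt1.
  have ap : 0 < pi *+ 2 / p%:R :> R.
    by apply: divr_gt0; [rewrite pmulrn_lgt0 | rewrite ltr0n prime_gt0].
  have ale : pi *+ 2 / p%:R <= pi :> R.
    by rewrite ler_pdivrMr ?ltr0n ?prime_gt0 // -[pi *+ 2]mulr_natr ler_wpM2l // ltW.
  by rewrite gtr0_norm // ltr_cos // in_itv /= ?lexx ?(ltW ap) ?(ltW pi0) ?ale //.
have : (1 - cosF 1) * (C ^+ 2 + S ^+ 2) = 0.
  transitivity (C * (C - C * cosF 1) + S * (S - S * cosF 1)); first by ring.
  have -> : C - C * cosF 1 = - (S * sinF 1) by rewrite {1}eC; ring.
  have -> : S - S * cosF 1 = C * sinF 1 by rewrite {1}eS; ring.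
  by ring.
move/eqP; rewrite mulf_eq0 subr_eq0 (gt_eqF c1) /= paddr_eq0 ?sqr_ge0 //.
by rewrite sqrf_eq0 => /andP[/eqP].
Qed.

Lemma orthogonality x : \sum_z cosF (z * x) = (x == 0)%:R * p%:R.
Proof.
have [->|x0] := eqVneq x 0.
  under eq_bigr => z _ do rewrite mulr0 cosF0.
  by rewrite sumr_const card_Fp // mul1r.
by rewrite mul0r -[RHS]sum_cosF [RHS](reindex_inj (mulIf x0)).
Qed.

Lemma orthogonality2 x y :
  \sum_z cosF (z * x) * cosF (z * y) = p%:R / 2 * ((x == - y)%:R + (x == y)%:R).
Proof.
transitivity ((\sum_z cosF (z * (x + y)) + \sum_z cosF (z * (x - y))) / 2).
  rewrite -big_split mulr_suml; apply: eq_bigr => z _ /=.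
  by rewrite mulrDr mulrBr cosFD cosFB; field.
by rewrite !orthogonality addr_eq0 subr_eq0; field.
Qed.

(** The squared modulus of the Fourier coefficient of [X] at [z], written with real and imaginary
    parts. *)
Definition fourier2 (X : {set 'F_p}) (z : 'F_p) : R :=
  (\sum_(x in X) cosF (z * x)) ^+ 2 + (\sum_(x in X) sinF (z * x)) ^+ 2.

Lemma fourier2_ge0 X z : 0 <= fourier2 X z.
Proof. by rewrite addr_ge0 ?sqr_ge0. Qed.

Lemma fourier20 X : fourier2 X 0 = #|X|%:R ^+ 2.
Proof.
rewrite /fourier2.
under eq_bigr => x _ do rewrite mul0r cosF0.
under [X in _ + X ^+ 2]eq_bigr => x _ do rewrite mul0r sinF0.
by rewrite !sumr_const mul0rn expr0n addr0.
Qed.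

Lemma fourier2E X z : fourier2 X z = \sum_x (rdiff X x)%:R * cosF (z * x).
Proof.
rewrite -(sum_rdiff X (fun x => cosF (z * x))) /fourier2 !expr2 !big_distrlr /= -big_split /=.
apply: eq_bigr => x _; rewrite -big_split; apply: eq_bigr => y _ /=.
by rewrite mulrBr cosFB.
Qed.

Lemma sum_fourier2 X : \sum_z fourier2 X z = p%:R * #|X|%:R.
Proof.
under eq_bigr => z _ do rewrite fourier2E.
rewrite exchange_big (bigD1 0) //= [X in _ + X]big1 => [|x x0].
  rewrite -mulr_sumr orthogonality eqxx mul1r addr0 mulrC; congr (_ * _%:R).
  by apply: eq_card => x; rewrite inE subr0 andbb.
by rewrite -mulr_sumr orthogonality (negPf x0) mul0r mulr0.
Qed.

(** Parseval for the functions [rdiff X] and [rdiff Y], whose transforms are [fourier2 X] and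
    [fourier2 Y]. The cosine product yields [x = y] and [x = - y]; the two terms agree because
    [rdiff] is even. *)
Lemma sum_fourier2M X Y :
  \sum_z fourier2 X z * fourier2 Y z = p%:R * \sum_x (rdiff X x)%:R * (rdiff Y x)%:R.
Proof.
have sum1 (f : 'F_p -> R) a : \sum_y f y * (a == y)%:R = f a.
  rewrite (bigD1 a) //= eqxx mulr1 big1 ?addr0 // => y ya.
  by rewrite eq_sym (negPf ya) mulr0.
transitivity (\sum_x \sum_y (rdiff X x)%:R * (rdiff Y y)%:R *
    (p%:R / 2 * ((x == - y)%:R + (x == y)%:R)) : R).
  under eq_bigr => z _ do rewrite !fourier2E big_distrlr /=.
  rewrite exchange_big; apply: eq_bigr => x _; rewrite exchange_big; apply: eq_bigr => y _ /=.
  rewrite -orthogonality2 mulr_sumr; apply: eq_bigr => z _; ring.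
rewrite mulr_sumr; apply: eq_bigr => x _.
transitivity (p%:R / 2 * (rdiff X x)%:R *
   (\sum_y (rdiff Y y)%:R * (- x == y)%:R + \sum_y (rdiff Y y)%:R * (x == y)%:R) : R).
  rewrite -big_split mulr_sumr; apply: eq_bigr => y _ /=; rewrite eqr_oppLR; ring.
by rewrite !(sum1 (fun y => (rdiff Y y)%:R)) rdiffN; field.
Qed.

End Characters.

(* Here [n = |A|], [s = |A + A|], [E] is the additive energy of [A] and
   [N = sum_x r_(S-S)(x) r_(A-A)(x)]; the left side of the conclusion bounds [q N]
   from above if all non-trivial Fourier coefficients of [A] are below [109/150 n]. *)
Lemma fourier_numerics (R : realFieldType) (n s q N E : R) (c := (109 / 150) ^+ 2) :
  100 < n -> 2000 * n < 9 * q -> 100 * s + 300 < 259 * n -> 0 < s ->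
  n ^+ 3 - n ^+ 2 + E <= N -> n ^+ 4 <= s * E ->
  s ^+ 2 * n ^+ 2 + c * n ^+ 2 * (q * s - s ^+ 2) < q * N.
Proof.
move=> hn' hp' hs' s0 hN hE; rewrite ltNge; apply/negP=> hF.
have q0 : 0 < q by lra.
have n0 : 0 < n by lra.
(* The negated conclusion is multiplied by [s], [n ^+ 4 <= s * E] is inserted, and [n ^+ 2] is
   cancelled. *)
have main : q * (s * n - s + n ^+ 2) <= c * q * s ^+ 2 + (1 - c) * s ^+ 3.
  rewrite -(ler_pM2l (exprn_gt0 2 n0)).
  have -> : n ^+ 2 * (c * q * s ^+ 2 + (1 - c) * s ^+ 3) =
    s * (s ^+ 2 * n ^+ 2 + c * n ^+ 2 * (q * s - s ^+ 2)) by ring.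
  apply: le_trans (ler_wpM2l (ltW s0) hF).
  have -> : n ^+ 2 * (q * (s * n - s + n ^+ 2)) =
    q * (s * (n ^+ 3 - n ^+ 2) + n ^+ 4) by ring.
  rewrite mulrCA ler_pM2l //.
  apply: le_trans (ler_wpM2l (ltW s0) hN); by rewrite [X in _ <= X]mulrDr lerD2l.
have cube : s ^+ 3 <= (259 / 100) ^+ 2 * (9 / 2000) * (q * (n * s)).
  have sn : s <= 259 / 100 * n by lra.
  have e1 : s ^+ 3 <= (259 / 100 * n) ^+ 2 * s.
    by rewrite exprSr ler_wpM2r ?(ltW s0) // ler_sqr ?nnegrE; lra.
  apply: le_trans e1 _.
  have e2 : n * (n * s) <= 9 / 2000 * q * (n * s).
    by rewrite ler_wpM2r ?mulr_ge0; lra.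
  by move: e2; rewrite /=; lra.
(* [57/4000] rounds up [(1 - c) * (259/100)^2 * 9/2000], the coefficient that [cube] gives to the
   cubic term of [main]. The left side is estimated at the end [259/100 n - 3] of the range of
   [s]. *)
have quad : c * s ^+ 2 + 57 / 4000 * (n * s) < s * n - s + n ^+ 2.
  have e : s * (c * s + 57 / 4000 * n - n + 1) <=
      (259 / 100 * n - 3) * (c * (259 / 100 * n - 3) + 57 / 4000 * n - n + 1).
    apply: (le_trans (ler_wpM2l (ltW s0)
      (_ : _ <= c * (259 / 100 * n - 3) + 57 / 4000 * n - n + 1))).
      by rewrite /c; lra.
    by apply: ler_wpM2r; rewrite /c; lra.
  have : (259 / 100 * n - 3) * (c * (259 / 100 * n - 3) + 57 / 4000 * n - n + 1) < n ^+ 2.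
    rewrite /c; nra.
  by move: e; rewrite /c; lra.
have := ltr_pM2l q0; move=> /(_ _ _) e; move: quad; rewrite -e => quad.
have : (1 - c) * s ^+ 3 <= q * (57 / 4000 * (n * s)).
  apply: le_trans (ler_wpM2l _ cube) _; first by rewrite /c; lra.
  have : 0 <= q * (n * s) by rewrite !mulr_ge0 // ltW.
  rewrite /c; lra.
move: main quad; rewrite /c; lra.
Qed.

(** If all non-trivial coefficients of [A] were small, Parseval for [A + A] would bound the
    non-trivial part of [sum_fourier2M], against Katz-Koester. *)
Lemma large_fourier_coefficient (R : realType) (p : nat) (A : {set 'F_p}) :
  prime p -> (100 < #|A|)%N -> (2000 * #|A| < 9 * p)%N ->
  (100 * #|sumset A A| + 300 < 259 * #|A|)%N ->
  exists2 z : 'F_p, z != 0 & (109 / 150 * #|A|%:R) ^+ 2 <= fourier2 R A z.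
Proof.
move=> pp hn hp hs.
have [/existsP[z /andP[z0 hz]]|/existsPn no] :=
  boolP [exists z : 'F_p, (z != 0) && ((109 / 150 * #|A|%:R) ^+ 2 <= fourier2 R A z)].
  by exists z.
exfalso; set S := sumset A A in hs.
have small : (2 * #|A| <= p)%N by move: hp; card_lia.
have S0 : (0 < #|S|)%N.
  have /card_gt0P[a aA] : (0 < #|A|)%N by apply: leq_trans hn.
  by apply/card_gt0P; exists (a + a); apply: mem_sumset.
set n : R := #|A|%:R; set s : R := #|S|%:R; set q : R := p%:R.
have hn' : 100 < n by rewrite ltr_nat.
have hp' : 2000 * n < 9 * q by rewrite -!natrM ltr_nat.
have hs' : 100 * s + 300 < 259 * n by rewrite -!natrM -natrD ltr_nat.
have s0 : 0 < s by rewrite ltr0n.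
pose N : R := \sum_x (rdiff S x)%:R * (rdiff A x)%:R.
pose E : R := \sum_x (rdiff A x)%:R ^+ 2.
have hN : n ^+ 3 - n ^+ 2 + E <= N by apply: katz_koester_energy.
have hE : n ^+ 4 <= s * E by apply: energy_ge.
pose c : R := (109 / 150) ^+ 2.
have hF : q * N <= s ^+ 2 * n ^+ 2 + c * n ^+ 2 * (q * s - s ^+ 2).
  rewrite -(sum_fourier2M R pp S A) (bigD1 0) //= !fourier20 lerD2l.
  have -> : q * s - s ^+ 2 = \sum_(z | z != 0) fourier2 R S z.
    have := sum_fourier2 R pp S; rewrite (bigD1 0) //= fourier20 => <-.
    by rewrite addrAC subrr add0r.
  rewrite mulr_sumr; apply: ler_sum => z z0; rewrite mulrC.
  apply: ler_wpM2r; first exact: fourier2_ge0.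
  have := no z; rewrite z0 /= -ltNge => /ltW /le_trans; apply.
  by rewrite /c exprMn.
have := fourier_numerics hn' hp' hs' s0 hN hE.
by rewrite ltNge hF.
Qed.

(** * From a large Fourier coefficient to a half-circle *)

Section LayerCake.
Variables (R : realFieldType) (T : finType) (A : {set T}).
Implicit Types (c : T -> R) (s B N : R).

(** Its integral over [s >= 0] is the sum of [c] over [A]. Hence some level reaches the mean, which
    the lemmas below prove by finite induction in place of integration. *)
Definition level_excess c s : R :=
  #|[set a in A | s < c a]|%:R - #|[set a in A | c a < - s]|%:R.

Lemma level_excess_sg c : level_excess c 0 = \sum_(a in A) Num.sg (c a).
Proof.
rewrite /level_excess -!sum1_card !natr_sum.
rewrite (eq_bigl (fun a => (a \in A) && (0 < c a))) => [|a]; last by rewrite inE.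
rewrite [X in _ - X](eq_bigl (fun a => (a \in A) && (c a < 0))) => [|a]; last by rewrite inE oppr0.
rewrite !big_mkcondr -sumrB /=; apply: eq_bigr => a _.
by case: (ltgtP (c a) 0) => [h|h|->]; [rewrite ltr0_sg|rewrite gtr0_sg|rewrite sgr0];
  rewrite ?subr0 ?sub0r.
Qed.

(* Peel off the layer of height [m], the least non-zero value of [`|c|]. *)
Lemma layer_cake_lt c B N : 0 < B -> (forall a, a \in A -> `|c a| <= B) ->
  (forall s, 0 <= s < B -> level_excess c s < N) -> \sum_(a in A) c a < B * N.
Proof.
have [k] := ubnP #|[set a in A | c a != 0]|.
elim: k c B => // k IH c B; rewrite ltnS => ck B0 cB ex.
have [/existsP[a0 /andP[a0A ca0]]|/existsPn no] :=
  boolP [exists a, (a \in A) && (c a != 0)]; last first.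
  have c0 a : a \in A -> c a = 0 by move=> aA; have := no a; rewrite aA negbK => /eqP.
  have := ex 0; rewrite lexx B0 level_excess_sg => /(_ isT).
  rewrite !big1 => [N0|a aA|a aA]; rewrite ?c0 ?sgr0 //; exact: mulr_gt0.
have P0 : (a0 \in A) && (c a0 != 0) by rewrite a0A.
have [a1 /andP[a1A ca1] amin] :=
  @arg_minP _ R _ a0 (fun a => (a \in A) && (c a != 0)) (fun a => `|c a|) P0.
have [m mE] : exists m : R, m = `|c a1| by exists `|c a1|.
have {}amin a : (a \in A) && (c a != 0) -> m <= `|c a| by rewrite mE; apply: amin.
have m0 : 0 < m by rewrite mE normr_gt0.
have mB : m <= B by rewrite mE; apply: cB.
(* All non-zero values move towards 0 by [m], which shifts the levels by [m] and makes at least one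
   more value vanish. *)
pose c' a := c a - Num.sg (c a) * m.
have c'abs a : a \in A -> c a != 0 -> m <= `|c a| by move=> aA ca; apply: amin; rewrite aA.
have sumE : \sum_(a in A) c a = \sum_(a in A) c' a + m * level_excess c 0.
  by rewrite level_excess_sg sumrB -mulr_suml mulrC subrK.
have ex0 : level_excess c 0 < N by apply: ex; rewrite lexx.
have c'B a : a \in A -> `|c' a| <= B - m.
  move=> aA; rewrite /c'; have := cB a aA; have := c'abs a aA.
  case: (ltgtP (c a) 0) => [h|h|->].
  - rewrite (ltr0_sg h) ltr0_norm // => /(_ isT) e1 e2; rewrite ler0_norm; lra.
  - rewrite (gtr0_sg h) gtr0_norm // => /(_ isT) e1 e2; rewrite ger0_norm; lra.
  - by rewrite sgr0 mul0r subr0 normr0 subr_ge0.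
have exE s : 0 <= s -> level_excess c' s = level_excess c (s + m).
  move=> s0; congr (_%:R - _%:R); apply: eq_card => a; rewrite !inE; case aA: (a \in A) => //=.
    rewrite /c'; have := c'abs a aA.
    case: (ltgtP (c a) 0) => [h|h|->].
    - by rewrite (ltr0_sg h) ltr0_norm // => /(_ isT) e1; apply/idP/idP; lra.
    - by rewrite (gtr0_sg h) gtr0_norm // => /(_ isT) e1; apply/idP/idP; lra.
    - by rewrite sgr0 => _; apply/idP/idP; lra.
  rewrite /c'; have := c'abs a aA.
  case: (ltgtP (c a) 0) => [h|h|->].
  - by rewrite (ltr0_sg h) ltr0_norm // => /(_ isT) e1; apply/idP/idP; lra.
  - by rewrite (gtr0_sg h) gtr0_norm // => /(_ isT) e1; apply/idP/idP; lra.
  - by rewrite sgr0 => _; apply/idP/idP; lra.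
rewrite sumE -[B](subrK m) mulrDl.
have [Bm|Bm] := eqVneq m B.
  rewrite big1 => [|a aA]; last first.
    by apply/eqP; rewrite -normr_le0; have := c'B a aA; rewrite Bm subrr.
  by rewrite Bm subrr mul0r !add0r ltr_pM2l.
apply: ltrD; last by rewrite ltr_pM2l.
apply: IH => //.
- apply: leq_trans ck; apply: proper_card; apply/properP; split.
    apply/subsetP=> a; rewrite !inE => /andP[-> /=]; apply: contra => /eqP ca.
    by rewrite /c' ca sgr0 mul0r subr0.
  by exists a1; rewrite !inE a1A ?ca1 //= /c' mE -numEsg subrr eqxx.
- by rewrite subr_gt0 lt_def eq_sym Bm.
by move=> s /andP[s0 sB]; rewrite exE //; apply: ex; apply/andP; split; lra.
Qed.

Lemma layer_cake c : (forall a, a \in A -> `|c a| <= 1) ->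
  exists2 s, 0 <= s < 1 & \sum_(a in A) c a <= level_excess c s.
Proof.
move=> c1; have [//|no] := boolp.pselect
  (exists2 s, 0 <= s < 1 & \sum_(a in A) c a <= level_excess c s).
suff : \sum_(a in A) c a < 1 * \sum_(a in A) c a by rewrite mul1r ltxx.
apply: layer_cake_lt => // s s01.
by rewrite ltNge; apply/negP=> le; apply: no; exists s.
Qed.

End LayerCake.

Section HalfArc.
Variables (R : realType) (p : nat).
Hypotheses (pp : prime p) (p2 : (2 < p)%N).

Let q0 : 0 < p%:R :> R.
Proof. by rewrite ltr0n prime_gt0. Qed.

(** With [(x, y) = (sin t, cos t)] the condition says that the sine of the angle of [a] plus [t] is
    non-negative, a half-turn beginning at [- t]. An index [j] with [2 j > p] lands strictly inside
    the opposite half-turn. *)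
Lemma half_plane_interval (x y : R) : x ^+ 2 + y ^+ 2 = 1 ->
  exists u : 'F_p, forall a : 'F_p,
    0 <= x * cosF R a + y * sinF R a -> (2 * val (a - u)%R < p)%N.
Proof.
move=> xy.
have [t [/andP[t1 t2] -> ->]] : exists t, [/\ - pi <= t <= pi, x = sin t & y = cos t].
  have y2 : y ^+ 2 <= 1 by rewrite -xy lerDr sqr_ge0.
  have y1 : -1 <= y <= 1.
    by rewrite -ler_norml -(@ler_sqr _ `|y|) ?nnegrE // real_normK ?num_real // expr1n.
  have sE : sin (acos y) = `|x|.
    rewrite sin_acos // (_ : 1 - y ^+ 2 = x ^+ 2) ?sqrtr_sqr //; lra.
  have cE : cos (acos y) = y by apply: acosK; rewrite in_itv.
  have a0 := acos_ge0 y1; have api := acos_lepi y1.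
  have [x0|x0] := lerP 0 x.
    exists (acos y); rewrite sE cE ger0_norm //; split=> //; apply/andP; split; lra.
  exists (- acos y); rewrite sinN cosN sE cE ltr0_norm // opprK; split=> //.
  by apply/andP; split; lra.
have pi0 := @pi_gt0 R.
(* [u] is the first lattice point after the angle [- t], shifted by a full turn. *)
pose v : R := (pi *+ 2 - t) * p%:R / (pi *+ 2).
have v0 : 0 < v by rewrite !mulr_gt0 ?invr_gt0 //; lra.
have exu : exists u, v <= u%:R.
  by exists (Num.bound v); apply: ltW; apply: archi_boundP; apply: ltW.
case: (ex_minnP exu) => u vu umin.
have u0 : (0 < u)%N by rewrite -(ltr0n R); apply: lt_le_trans vu.
have uv : u%:R < v + 1.
  rewrite -(prednK u0) -natr1 ltrD2r ltNge; apply/negP=> /umin.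
  by rewrite leqNgt ltn_predL u0.
pose e := angle R p u + t - pi *+ 2.
have pi2 : 0 < pi *+ 2 :> R by lra.
have vE : pi *+ 2 * v / p%:R = pi *+ 2 - t.
  by rewrite /v; move: (pi *+ 2) pi2 => w w0; field; rewrite !gt_eqF.
have e0 : 0 <= e.
  have : pi *+ 2 * v / p%:R <= angle R p u.
    by rewrite /angle ler_wpM2r ?invr_ge0 ?(ltW q0) // ler_wpM2l // (ltW pi2).
  by rewrite vE /e; lra.
have e1 : e < pi *+ 2 / p%:R.
  have : angle R p u < pi *+ 2 * (v + 1) / p%:R.
    by rewrite /angle ltr_pM2r ?invr_gt0 // ltr_pM2l.
  by rewrite mulrDr mulrDl vE mulr1 /e; lra.
exists u%:R => a; set j := val (a - u%:R)%R.
have aE : val a = ((u + j) %% p)%N.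
  have e2 : a = (u + j)%:R by rewrite natrD /j natr_Zp addrC subrK.
  exact: etrans (congr1 val e2) (val_Fp_nat pp _).
rewrite /cosF /sinF aE cos_angle_mod // sin_angle_mod // -sinD [t + _]addrC.
have -> : sin (angle R p (u + j) + t) = sin (angle R p j + e).
  rewrite -(sinD2pi (angle R p j + e)); congr sin; rewrite angleD /e; ring.
rewrite leNgt; apply: contraNltn => le.
have lt : (p < 2 * j)%N.
  rewrite ltn_neqAle le andbT; apply/eqP=> pj.
  have := even_prime pp; rewrite pj mul2n odd_double; case=> // j2.
  by move: p2; rewrite pj mul2n j2.
have jp : (j.+1 <= p)%N by apply: ltn_Fp.
have h1 : pi < angle R p j.
  rewrite /angle ltr_pdivlMr // (_ : pi *+ 2 * j%:R = pi * (2 * j)%:R).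
    by rewrite ltr_pM2l // ltr_nat.
  by rewrite natrM mulrA [pi * _]mulr_natr.
have h2 : angle R p j + pi *+ 2 / p%:R <= pi *+ 2.
  rewrite /angle -mulrDl -[X in _ + X]mulr1 -mulrDr natr1 ler_pdivrMr //.
  by rewrite ler_pM2l // ler_nat.
rewrite -[angle R p j + e](subrK pi) sinDpi oppr_lt0.
by apply: sin_gt0_pi; apply/andP; split; lra.
Qed.

Lemma half_arc (A : {set 'F_p}) (M : R) : 0 < M -> M ^+ 2 <= fourier2 R A 1 ->
  exists u : 'F_p, #|A|%:R + M <= 2 * #|[set a in A | (2 * val (a - u)%R < p)%N]|%:R.
Proof.
move=> M0; rewrite /fourier2.
under eq_bigr => a _ do rewrite mul1r.
under [X in _ + X ^+ 2]eq_bigr => a _ do rewrite mul1r.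
set X := \sum_(a in A) cosF R a; set Y := \sum_(a in A) sinF R a => MXY.
pose D : R := Num.sqrt (X ^+ 2 + Y ^+ 2).
have D2 : D ^+ 2 = X ^+ 2 + Y ^+ 2 by rewrite sqr_sqrtr // addr_ge0 ?sqr_ge0.
have MD : M <= D by rewrite -(@ler_sqr _ M) ?nnegrE ?sqrtr_ge0 ?(ltW M0) // D2.
have D0 : D != 0 by rewrite gt_eqF //; apply: lt_le_trans MD.
pose x := X / D; pose y := Y / D.
have xy : x ^+ 2 + y ^+ 2 = 1 by rewrite /x /y !expr_div_n -mulrDl -D2 divff ?expf_neq0.
pose c (a : 'F_p) := x * cosF R a + y * sinF R a.
pose d (a : 'F_p) := x * sinF R a - y * cosF R a.
have cd a : c a ^+ 2 + d a ^+ 2 = 1.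
  transitivity ((x ^+ 2 + y ^+ 2) * (cosF R a ^+ 2 + sinF R a ^+ 2)); first by rewrite /c /d; ring.
  by rewrite xy cosF2sinF2 mulr1.
have c1 a : a \in A -> `|c a| <= 1.
  move=> _; rewrite -(@ler_sqr _ `|c a|) ?nnegrE // real_normK ?num_real // expr1n.
  by rewrite -(cd a) lerDl sqr_ge0.
have sumc : \sum_(a in A) c a = D.
  rewrite big_split /= -!mulr_sumr -/X -/Y /x /y.
  apply: (mulIf D0); rewrite -expr2 D2; by field.
have [s /andP[s0 s1] ex] := layer_cake c1; rewrite sumc in ex.
pose t : R := Num.sqrt (1 - s ^+ 2).
have s2 : s ^+ 2 < 1 by rewrite expr_lt1.
have t2 : t ^+ 2 = 1 - s ^+ 2 by rewrite sqr_sqrtr // subr_ge0 ltW.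
have t0 : 0 < t by rewrite sqrtr_gt0 subr_gt0.
(* [c] and [d] are coordinates along and across the direction of the coefficient. The normals of the
   two half-planes are this direction rotated by plus and minus the angle of sine [s]. Points with
   [c > s] lie in both and points in neither have [c < - s], so [|H1| + |H2|] exceeds [|A|] by at
   least the level excess. *)
pose H1 := [set a in A | 0 <= s * d a + t * c a].
pose H2 := [set a in A | 0 <= t * c a - s * d a].
pose P := [set a in A | s < c a]; pose Q := [set a in A | c a < - s].
have key a : (t * c a) ^+ 2 - (s * d a) ^+ 2 = c a ^+ 2 - s ^+ 2.
  rewrite !exprMn t2; have -> : d a ^+ 2 = 1 - c a ^+ 2 by rewrite -(cd a) addrC addKr.
  by ring.
have sub1 : A \subset H1 :|: H2 :|: Q.
  apply/subsetP=> a aA; rewrite !inE aA /=; apply: contraT.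
  rewrite !negb_or -!ltNge -leNgt => /andP[/andP[h1 h2] h3].
  have : (t * c a) ^+ 2 <= (s * d a) ^+ 2.
    have c0 : c a < 0 by rewrite -(pmulr_rlt0 _ t0); lra.
    rewrite -subr_le0 key subr_le0 -sqrrN ler_sqr ?nnegrE //; lra.
  have : (s * d a) ^+ 2 < (t * c a) ^+ 2.
    rewrite -subr_gt0 subr_sqr nmulr_lgt0; lra.
  by lra.
have sub2 : P \subset H1 :&: H2.
  apply/subsetP=> a; rewrite !inE => /andP[aA sc]; rewrite aA /=.
  have c0 : 0 < c a by lra.
  have le : `|s * d a| <= t * c a.
    have tc0 : 0 <= t * c a by rewrite mulr_ge0 // ltW.
    rewrite -(@ler_sqr _ `|_|) ?nnegrE // real_normK ?num_real // -subr_ge0 key subr_ge0.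
    by rewrite ler_sqr ?nnegrE //; lra.
  by move: le; rewrite ler_norml => /andP[le1 le2]; apply/andP; split; lra.
have count : (#|A| + #|P| <= #|H1| + #|H2| + #|Q|)%N.
  have := subset_leq_card sub1; have := subset_leq_card sub2; have := cardsUI H1 H2.
  by have := cardsUI (H1 :|: H2) Q; card_lia.
have big : #|A|%:R + M <= #|H1|%:R + #|H2|%:R.
  by move: ex count; rewrite /level_excess -/P -/Q -(ler_nat R) !natrD; lra.
have arc x' y' (H : {set 'F_p}) : x' ^+ 2 + y' ^+ 2 = 1 -> #|A|%:R + M <= 2 * #|H|%:R ->
    H = [set a in A | 0 <= x' * cosF R a + y' * sinF R a] ->
    exists u : 'F_p, #|A|%:R + M <= 2 * #|[set a in A | (2 * val (a - u)%R < p)%N]|%:R.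
  move=> xy' le HE; have [u hu] := half_plane_interval xy'; exists u.
  apply: (le_trans le); rewrite ler_wpM2l // ler_nat HE; apply: subset_leq_card.
  by apply/subsetP=> a; rewrite !inE => /andP[-> /hu ->].
have [le|lt] := lerP (#|A|%:R + M) (2 * #|H1|%:R).
  apply: (arc (t * x - s * y) (s * x + t * y)) le _.
    transitivity ((t ^+ 2 + s ^+ 2) * (x ^+ 2 + y ^+ 2)); first by ring.
    by rewrite xy t2 subrK mulr1.
  apply/setP=> a; rewrite !inE; congr (_ && (0 <= _)); rewrite /c /d; ring.
apply: (arc (t * x + s * y) (t * y - s * x) H2).
- transitivity ((t ^+ 2 + s ^+ 2) * (x ^+ 2 + y ^+ 2)); first by ring.
  by rewrite xy t2 subrK mulr1.
- by move: big lt; lra.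
by apply/setP=> a; rewrite !inE; congr (_ && (0 <= _)); rewrite /c /d; ring.
Qed.

End HalfArc.

(** * From the half-circle to the whole set *)

Definition in_progression (p : nat) (k : nat) (X : {set 'F_p}) :=
  exists a d : 'F_p, d != 0 /\ X \subset arith_prog a d k.

Lemma in_progression_affine (p k : nat) (a d : 'F_p) (X : {set 'F_p}) : d != 0 ->
  in_progression k (affine a d X) -> in_progression k X.
Proof.
move=> d0 [b [e [e0 /(affine_arith_prog (- a / d) d^-1)]]]; rewrite affineK // => sX.
by exists (- a / d + d^-1 * b), (d^-1 * e); rewrite mulf_neq0 ?invr_eq0.
Qed.

(* The part [X0] of [X] in a half-circle is covered by a short progression; an
   element of [X] far from that progression would give [X0 + X0] a disjoint
   translate of [X0], making [X + X] too large.  So all of [X] is rectifiable. *)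
Lemma in_progression_half (p : nat) (X : {set 'F_p})
    (X0 := [set x in X | (2 * val x < p)%N]) :
  prime p -> (2000 * #|X| < 9 * p)%N -> (100 * #|sumset X X| + 300 < 259 * #|X|)%N ->
  (259 * #|X| <= 300 * #|X0|)%N ->
  in_progression (#|sumset X X| - #|X| + 1) X.
Proof.
move=> pp hp hs h0.
have sX0 : X0 \subset X by apply/subsetP=> x; rewrite inE => /andP[].
have c2 : (#|sumset X0 X0| <= #|sumset X X|)%N by apply: subset_leq_card; apply: sumsetS.
have c1 : (#|X0| <= #|X|)%N by apply: subset_leq_card.
have [] := @freiman_3n4 p X0 pp.
- by move=> x; rewrite inE => /andP[].
- by move: c2 hs h0; card_lia.
move=> a [d []]; set k := (_ + 1)%N => d0 sAP.
have k0 : (0 < k)%N by rewrite /k addn1.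
have kp : (300 * k + 600 <= 518 * #|X|)%N by rewrite /k; move: c2 hs h0; card_lia.
pose Y := affine (- a / d) d^-1 X; pose Y0 := affine (- a / d) d^-1 X0.
have dV : d^-1 != 0 by rewrite invr_eq0.
apply: (in_progression_affine (a := - a / d) dV); rewrite -/Y.
have cY : #|Y| = #|X| by rewrite card_affine.
have cYY : #|sumset Y Y| = #|sumset X X| by rewrite sumset_affine card_affine.
have cY0 : #|Y0| = #|X0| by rewrite card_affine.
have sY0 : Y0 \subset Y by apply: imsetS.
have Y0k y : y \in Y0 -> exists2 i, (i < k)%N & y = i%:R.
  move/(subsetP (affine_arith_prog (- a / d) d^-1 sAP)) => /imsetP[i _ ->].
  by exists i => //; rewrite mulVf // mulNr mulrC addNr add0r.
(* [Y0] lies in [[0, k - 1]]. If [y] is outside [[- (k - 1), 2 (k - 1)]], then [y + Y0] misses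
   [Y0 + Y0], so [Y + Y] has at least [3 |Y0| - 1] elements, too many. The shift by [k - 1] makes
   this interval start at 0. *)
have near y : y \in Y -> (val (y + k.-1%:R)%R <= 3 * k.-1)%N.
  move=> yY; rewrite leqNgt; apply/negP=> far.
  have disj : [disjoint sumset Y0 Y0 & translate y Y0].
    apply/pred0P=> s /=; apply/andP=> -[/sumsetP[_ [_ [/Y0k[j jk ->] /Y0k[l lk ->] ->]]]].
    rewrite mem_translate => /Y0k[i ik e].
    have yE : y + k.-1%:R = (j + l + (k.-1 - i))%:R.
      rewrite !natrD natrB; last by move: ik k0; clear; lia.
      by rewrite -e; ring.
    move: far; rewrite yE [val _](val_Fp_nat pp) modn_small; last first.
      by move: ik jk lk kp hp; card_lia.
    by move: ik jk lk; clear; lia.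
  have sub : sumset Y0 Y0 :|: translate y Y0 \subset sumset Y Y.
    rewrite subUset sumsetS //=; apply/subsetP=> s; rewrite mem_translate => sY.
    by rewrite -[s](subrK y) mem_sumset // (subsetP sY0).
  have := subset_leq_card sub; rewrite cardsU (disjoint_setI0 disj) cards0 subn0.
  rewrite card_translate cY0 cYY.
  have N0 : Y0 != set0 by rewrite -card_gt0 cY0; move: h0 hs; card_lia.
  have := @cauchy_davenport p _ _ N0 N0.
  rewrite cardsT card_Fp // cY0 => cd; have {cd} := cd _.
  by move: hp h0 c1 hs; card_lia.
pose Z := affine k.-1%:R 1 Y.
apply: (in_progression_affine (a := k.-1%:R) (oner_neq0 _)); rewrite -/Z.
have cZ : #|Z| = #|X| by rewrite card_affine ?oner_neq0.
have cZZ : #|sumset Z Z| = #|sumset X X| by rewrite sumset_affine card_affine ?oner_neq0.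
rewrite -cZ -cZZ; apply: freiman_3n4 => //.
  move=> _ /imsetP[y /near le ->]; rewrite mul1r addrC.
  by move: le; move: (val _) => v; move: kp k0 hp; card_lia.
by rewrite cZ cZZ; move: hs; card_lia.
Qed.

(** Dilation by [z] moves the large coefficient to frequency 1, the one treated by [half_arc]. *)
Lemma fourier2_affine (R : realType) (p : nat) (A : {set 'F_p}) (z : 'F_p) :
  z != 0 -> fourier2 R (affine 0 z A) 1 = fourier2 R A z.
Proof.
move=> z0; rewrite /fourier2 !big_imset /=; try by move=> x y _ _; apply: affine_inj.
by congr (_ ^+ 2 + _ ^+ 2); apply: eq_bigr => x _; rewrite mul1r add0r.
Qed.

(** Clears the denominators of the decimal hypotheses: [K] and [N] are the numerator and denominator
    of [c]. *)
Lemma ltn_mul_of_rat (c : rat) (N K n m : nat) : (0 < N)%N -> c * N%:R = K%:R ->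
  n%:R < c * m%:R -> (N * n < K * m)%N.
Proof.
move=> N0 cN lt; rewrite -(ltr_nat rat) !natrM -cN -mulrA mulrCA.
by rewrite ltr_pM2l // ltr0n.
Qed.

Theorem theorem4 (p : nat) (A : {set 'F_p}) :
  prime p ->
  (100 < #|A|)%N ->
  #|A|%:R < 0.0045%Q * p%:R :> rat ->
  #|sumset A A|%:R < 2.59%Q * #|A|%:R - 3 :> rat ->
  exists (a d : 'F_p) (k : nat),
    [/\ d != 0,
        (k <= #|sumset A A| - #|A| + 1)%N &
        A \subset arith_prog a d k].
Proof.
move=> pp hn hp' hs'.
have hp : (2000 * #|A| < 9 * p)%N.
  by apply: ltn_mul_of_rat hp'; last exact: (esym (numqE 0.0045%Q)).
have hs : (100 * #|sumset A A| + 300 < 259 * #|A|)%N.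
  rewrite -[300%N]/(100 * 3)%N -mulnDr.
  apply: (ltn_mul_of_rat _ (esym (numqE 2.59%Q))); first by [].
  by rewrite natrD -ltrBrDr.
clear hp' hs'.
suff [a [d [d0 sA]]] : in_progression (#|sumset A A| - #|A| + 1) A.
  by exists a, d, (#|sumset A A| - #|A| + 1)%N.
have [z z0 hz] := large_fourier_coefficient Rdefinitions.R pp hn hp hs.
have M0 : 0 < 109 / 150 * #|A|%:R :> Rdefinitions.R.
  by rewrite mulr_gt0 ?divr_gt0 ?ltr0n //; apply: leq_trans hn.
have p2 : (2 < p)%N by move: hn hp; card_lia.
rewrite -fourier2_affine // in hz.
have [u hu] := half_arc pp p2 M0 hz.
pose X := affine (- u) z A.
have cX : #|X| = #|A| by rewrite card_affine.
have cXX : #|sumset X X| = #|sumset A A| by rewrite sumset_affine card_affine.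
apply: (in_progression_affine (a := - u) z0).
rewrite -cX -cXX -/X; apply: in_progression_half; rewrite ?cX ?cXX //.
have e : #|[set a in affine 0 z A | (2 * val (a - u)%R < p)%N]| =
    #|[set x in X | (2 * val x < p)%N]|.
  rewrite -(card_translate (- u) [set a in affine 0 z A | _]); apply: eq_card => x.
  rewrite mem_translate !inE opprK addrK; congr (_ && _).
  apply/imsetP/imsetP => -[a aA xE]; exists a => //.
    by rewrite -[x](addrK u) xE add0r addrC.
  by rewrite xE add0r [- u + _]addrC subrK.
rewrite e card_affine // in hu; rewrite -(ler_nat Rdefinitions.R) !natrM.
have scale (F : realFieldType) (n m : F) : n + 109 / 150 * n <= 2 * m -> 259 * n <= 300 * m by lra.
exact: scale hu.
Qed.
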